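(* Let $W = Sp(1)$ be the Lie group of unit quaternions and let $G \subset \mathrm{Aut}(Sp(1)) = SO(3)$ be an arbitrary finite subgroup, of order $n$. Then the coset $n$-valued topological group $Sp(1)/G$ (the orbit space of the action of $G$ on $Sp(1)$, with the quotient topology) is homeomorphic to the sphere $S^3$.
   Context: **$n$-valued topological group.** A Hausdorff path-connected topological space $X$ with a base point $e \in X$, together with a continuous $n$-valued multiplication $\mu\colon X\times X \to \mathrm{Sym}^n X = X^n/S_n$ and a continuous involution $\mathrm{inv}\colon X\to X$ with $\mathrm{inv}(e)=e$, is called an $n$-valued topological group if: (1) $\mu(x,\mu(y,z)) = \mu(\mu(x,y),z) \in \mathrm{Sym}^{n^2}X$ for all $x,y,z\in X$; (2) $\mu(x,e)=\mu(e,x)=[x,x,\ldots,x]$ for all $x\in X$; (3) $\mu(x,\mathrm{inv}(x))\ni e$ and $\mu(\mathrm{inv}(x),x)\ni e$ for all $x\in X$. **Coset $n$-valued group.** Let $W$ be a compact connected Lie group and $G=\{g_1,\ldots,g_n\}\subset \mathrm{Aut}(W)$ a subgroup of order $n$ of its group of (Lie group) automorphisms. Let $X = W/G$ be the orbit space of the action of $G$ on $W$ by automorphisms, with the quotient topology, and let $\pi\colon W\to X$ be the canonical projection. Then $X$ is an $n$-valued topological group with identity $e=\pi(e_W)$, inverse $\mathrm{inv}(\pi(w)) = \pi(w^{-1})$, and multiplication $\mu(\pi(a),\pi(b)) = [\pi(a g_1(b)),\pi(a g_2(b)),\ldots,\pi(a g_n(b))]$ for all $a,b\in W$. This is called the coset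 $n$-valued topological group $W/G$. (It is not the space of cosets of a subgroup of $W$.) **Identification.** Every automorphism of $Sp(1)$ is conjugation $x\mapsto qxq^{-1}$ by an element $q\in Sp(1)$ that is unique up to sign, so $\mathrm{Aut}(Sp(1))$ is identified with $Sp(1)/\{1,-1\}\cong SO(3)$. *)

(* Defs.v *)
From HB Require Import structures.
From mathcomp Require Import all_boot all_order all_algebra generic_quotient.
From mathcomp Require Import ring.
From mathcomp Require Import all_classical all_reals all_analysis.

Set Implicit Arguments.
Unset Strict Implicit.
Unset Printing Implicit Defensive.

Import Order.TTheory GRing.Theory Num.Theory.
Import numFieldNormedType.Exports.

Local Open Scope classical_set_scope.
Local Open Scope ring_scope.
Local Open Scope quotient_scope.

Definition homeomorphic (X Y : topologicalType) : Prop :=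
  exists (f : X -> Y) (g : Y -> X),
    [/\ cancel f g, cancel g f, continuous f & continuous g].

HB.mixin Record Group_isTopological W & Topological W & Group W := {
  mulg_continuous : continuous (fun p : W * W => (p.1 * p.2)%g);
  invg_continuous : continuous (fun x : W => x^-1%g)
}.

#[short(type="topologicalGroupType")]
HB.structure Definition TopologicalGroup :=
  {W of Topological W & Group W & Group_isTopological W}.

Section automorphism_group.
Variable W : topologicalGroupType.

(* For a Lie group W these are exactly the Lie group automorphisms, a
   continuous homomorphism of Lie groups being automatically smooth. *)
Definition is_automorphism (f : W -> W) : Prop :=
  {morph f : x y / (x * y)%g} /\
  exists g : W -> W, [/\ cancel f g, cancel g f, continuous f & continuous g].

Definition topAut : Type := set_type [set f : W -> W | is_automorphism f].

HB.instance Definition _ := Choice.on topAut.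

Definition aut_fun (f : topAut) : W -> W := set_val f.
Coercion aut_fun : topAut >-> Funclass.

Lemma aut_inj (f g : topAut) : aut_fun f =1 aut_fun g -> f = g.
Proof. by move=> fg; apply/val_inj/funext. Qed.

Lemma autP (f : topAut) : is_automorphism f.
Proof. by have := set_valP f. Qed.

Lemma id_automorphism : is_automorphism id.
Proof. by split=> //; exists id; split=> // x; exact: cvg_id. Qed.

Lemma comp_automorphism (f g : topAut) : is_automorphism (f \o g).
Proof.
have [fM [f' [fK f'K cf cf']]] := autP f.
have [gM [g' [gK g'K cg cg']]] := autP g.
split=> [x y /=|]; first by rewrite gM fM.
exists (g' \o f'); split=> [x /=|x /=|x|x].
- by rewrite fK gK.
- by rewrite g'K f'K.
- by apply: continuous_comp; [exact: cg|exact: cf].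
- by apply: continuous_comp; [exact: cf'|exact: cg'].
Qed.

Definition mk_aut (f : W -> W) (fP : is_automorphism f) : topAut :=
  exist _ f (@mem_set _ [set f : W -> W | is_automorphism f] f fP).

Lemma inv_automorphism (f : topAut) : {g : topAut | cancel f g & cancel g f}.
Proof.
apply: cid2; have [fM [g [fK gK cf cg]]] := autP f.
have g_aut : is_automorphism g.
  split; last by exists f.
  by move=> x y; apply: (can_inj fK); rewrite fM !gK.
by exists (mk_aut g_aut).
Qed.

Definition aut_one : topAut := mk_aut id_automorphism.
Definition aut_mul (f g : topAut) : topAut := mk_aut (comp_automorphism f g).
Definition aut_inv (f : topAut) : topAut := s2val (inv_automorphism f).

Lemma aut_mulA : associative aut_mul.
Proof. by move=> f g h; exact: aut_inj. Qed.

Lemma aut_mul1 : left_id aut_one aut_mul.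
Proof. by move=> f; exact: aut_inj. Qed.

Lemma aut_mulr1 : right_id aut_one aut_mul.
Proof. by move=> f; exact: aut_inj. Qed.

Lemma aut_mulV : left_inverse aut_one aut_inv aut_mul.
Proof.
move=> f; apply: aut_inj => x; rewrite /aut_inv.
exact: s2valP (inv_automorphism f) x.
Qed.

Lemma aut_mulrV : right_inverse aut_one aut_inv aut_mul.
Proof.
move=> f; apply: aut_inj => x; rewrite /aut_inv.
exact: s2valP' (inv_automorphism f) x.
Qed.

HB.instance Definition _ :=
  isGroup.Build topAut aut_mulA aut_mul1 aut_mulr1 aut_mulV aut_mulrV.

End automorphism_group.

Section orbit_space.
Variables (W : topologicalGroupType) (G : groupClosed (topAut W)).

Definition same_orbit (x y : W) : bool :=
  `[< exists2 f : topAut W, f \in G & f x = y >].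

Lemma same_orbit_refl : reflexive same_orbit.
Proof. by move=> x; apply/asboolP; exists 1%g => //; exact: gpred1. Qed.

Lemma same_orbit_sym : symmetric same_orbit.
Proof.
suff sub x y : same_orbit x y -> same_orbit y x.
  by move=> x y; apply/idP/idP; exact: sub.
move=> /asboolP[f Gf <-]; apply/asboolP; exists f^-1%g; first by rewrite gpredV.
exact: (congr1 (fun h : topAut W => h x) (mulVg f)).
Qed.

Lemma same_orbit_trans : transitive same_orbit.
Proof.
move=> y x z /asboolP[f Gf <-] /asboolP[g Gg <-]; apply/asboolP.
by exists (g * f)%g => //; exact: gpredM.
Qed.

Definition orbit_rel :=
  EquivRel same_orbit same_orbit_refl same_orbit_sym same_orbit_trans.

(* The space underlying the coset n-valued group W/G: it consists of the
   G-orbits in W, not of the cosets of a subgroup of W. *)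
Definition coset_space : Type := {eq_quot orbit_rel}.

HB.instance Definition _ := Quotient.on coset_space.
HB.instance Definition _ :=
  Topological.copy coset_space (quotient_topology {eq_quot orbit_rel}).

End orbit_space.

Definition sphere (R : realType) (d : nat) : Type :=
  set_type [set x : 'rV[R]_d.+1 | \sum_i x ord0 i ^+ 2 = 1].

HB.instance Definition _ (R : realType) (d : nat) := Topological.on (sphere R d).

Section quaternions.
Variable R : realType.

(* The row vector (a, b, c, d) stands for the quaternion a + bi + cj + dk. *)
Definition quat : Type := 'rV[R]_4.

HB.instance Definition _ := Topological.on quat.

Definition mkquat (a b c d : R) : quat := \row_j [:: a; b; c; d]`_j.

Definition qre (q : quat) : R := q ord0 0.
Definition qi (q : quat) : R := q ord0 1.
Definition qj (q : quat) : R := q ord0 2%:R.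
Definition qk (q : quat) : R := q ord0 3%:R.

Definition qmul (p q : quat) : quat :=
  mkquat (qre p * qre q - qi p * qi q - qj p * qj q - qk p * qk q)
         (qre p * qi q + qi p * qre q + qj p * qk q - qk p * qj q)
         (qre p * qj q - qi p * qk q + qj p * qre q + qk p * qi q)
         (qre p * qk q + qi p * qj q - qj p * qi q + qk p * qre q).

Definition qconj (q : quat) : quat := mkquat (qre q) (- qi q) (- qj q) (- qk q).

Definition qnorm2 (q : quat) : R := qre q ^+ 2 + qi q ^+ 2 + qj q ^+ 2 + qk q ^+ 2.

Lemma qreE a b c d : qre (mkquat a b c d) = a. Proof. by rewrite /qre mxE. Qed.
Lemma qiE a b c d : qi (mkquat a b c d) = b. Proof. by rewrite /qi mxE. Qed.
Lemma qjE a b c d : qj (mkquat a b c d) = c. Proof. by rewrite /qj mxE. Qed.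
Lemma qkE a b c d : qk (mkquat a b c d) = d. Proof. by rewrite /qk mxE. Qed.

Definition quatE := (qreE, qiE, qjE, qkE).

Lemma quatP (p q : quat) :
  qre p = qre q -> qi p = qi q -> qj p = qj q -> qk p = qk q -> p = q.
Proof.
move=> e0 e1 e2 e3; apply/rowP => -[[|[|[|[|//]]]] i4].
- by move: e0; rewrite /qre; congr (p _ _ = q _ _); exact: val_inj.
- by move: e1; rewrite /qi; congr (p _ _ = q _ _); exact: val_inj.
- by move: e2; rewrite /qj; congr (p _ _ = q _ _); exact: val_inj.
- by move: e3; rewrite /qk; congr (p _ _ = q _ _); exact: val_inj.
Qed.

Lemma qmulA : associative qmul.
Proof. by move=> p q r; apply: quatP; rewrite /qmul !quatE; ring. Qed.

Lemma qnorm2M p q : qnorm2 (qmul p q) = qnorm2 p * qnorm2 q.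
Proof. by rewrite /qnorm2 /qmul !quatE; ring. Qed.

Definition Sp1 : Type := set_type [set q : quat | qnorm2 q = 1].

HB.instance Definition _ := Choice.on Sp1.
HB.instance Definition _ := Topological.on Sp1.

Lemma qnorm2_sp1 (x : Sp1) : qnorm2 (set_val x) = 1.
Proof. by have := set_valP x. Qed.

Definition to_sp1 (q : quat) (q1 : qnorm2 q = 1) : Sp1 :=
  exist _ q (@mem_set _ [set q | qnorm2 q = 1] q q1).

Lemma sp1_oneP : qnorm2 (mkquat 1 0 0 0) = 1.
Proof. by rewrite /qnorm2 !quatE; ring. Qed.

Lemma sp1_mulP (x y : Sp1) : qnorm2 (qmul (set_val x) (set_val y)) = 1.
Proof. by rewrite qnorm2M !qnorm2_sp1 mulr1. Qed.

Lemma sp1_invP (x : Sp1) : qnorm2 (qconj (set_val x)) = 1.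
Proof. by apply: etrans (qnorm2_sp1 x); rewrite /qnorm2 /qconj !quatE; ring. Qed.

Definition sp1_one : Sp1 := to_sp1 sp1_oneP.
Definition sp1_mul (x y : Sp1) : Sp1 := to_sp1 (sp1_mulP x y).
Definition sp1_inv (x : Sp1) : Sp1 := to_sp1 (sp1_invP x).

Lemma sp1_mulA : associative sp1_mul.
Proof. by move=> x y z; apply: val_inj; exact: qmulA. Qed.

Lemma sp1_mul1 : left_id sp1_one sp1_mul.
Proof. by move=> x; apply: val_inj; apply: quatP; rewrite /= /qmul !quatE; ring. Qed.

Lemma sp1_mulr1 : right_id sp1_one sp1_mul.
Proof. by move=> x; apply: val_inj; apply: quatP; rewrite /= /qmul !quatE; ring. Qed.

Lemma sp1_mulV : left_inverse sp1_one sp1_inv sp1_mul.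
Proof.
move=> x; apply: val_inj; apply: quatP; rewrite /= /qmul /qconj !quatE; try ring.
by apply: etrans (qnorm2_sp1 x); rewrite /qnorm2; ring.
Qed.

Lemma sp1_mulrV : right_inverse sp1_one sp1_inv sp1_mul.
Proof.
move=> x; apply: val_inj; apply: quatP; rewrite /= /qmul /qconj !quatE; try ring.
by apply: etrans (qnorm2_sp1 x); rewrite /qnorm2; ring.
Qed.

HB.instance Definition _ :=
  isGroup.Build Sp1 sp1_mulA sp1_mul1 sp1_mulr1 sp1_mulV sp1_mulrV.

Lemma mkquat_continuous (T : topologicalType) (a b c d : T -> R) :
  continuous a -> continuous b -> continuous c -> continuous d ->
  continuous (fun t => mkquat (a t) (b t) (c t) (d t)).
Proof.
move=> ca cb cc cd t A [P Pn sPA].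
have P_near j : \forall s \near t, P ord0 j (mkquat (a s) (b s) (c s) (d s) ord0 j).
  have := Pn ord0 j; rewrite /mkquat mxE.
  move=> Pj; suff : \forall s \near t, P ord0 j [:: a s; b s; c s; d s]`_j.
    by apply: filterS => s; rewrite mxE.
  move: Pj; case: j => -[|[|[|[|//]]]] j4 /=; [exact: ca|exact: cb|exact: cc|exact: cd].
have : \forall s \near t,
    forall j, P ord0 j (mkquat (a s) (b s) (c s) (d s) ord0 j).
  by apply: filter_forall => j; exact: P_near.
by apply: filterS => s Ps; apply: sPA => i j; rewrite (ord1 i); exact: Ps.
Qed.

Lemma sp1_continuous (T : topologicalType) (f : T -> Sp1) :
  continuous (set_val \o f : T -> quat) -> continuous f.
Proof. exact: continuous_comp_initial. Qed.

Lemma sp1_coord_continuous (T : topologicalType) (f : T -> Sp1) (i : 'I_4) :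
  continuous f -> continuous (fun t => (set_val (f t) : quat) ord0 i).
Proof.
move=> cf t.
have := @continuous_comp _ _ _ f (fun x : Sp1 => (set_val x : quat) ord0 i) t.
apply; first exact: cf.
have := @continuous_comp _ _ _ (set_val : Sp1 -> quat) (fun q : quat => q ord0 i).
apply.
  exact: initial_continuous.
exact: coord_continuous.
Qed.

Lemma sp1_mul_continuous : continuous (fun p : Sp1 * Sp1 => (p.1 * p.2)%g).
Proof.
pose T : topologicalType := (Sp1 * Sp1)%type.
have rD (u v : T -> R) :
    continuous u -> continuous v -> continuous (fun t => u t + v t).
  by move=> cu cv t; exact: cvgD (cu t) (cv t).
have rB (u v : T -> R) :
    continuous u -> continuous v -> continuous (fun t => u t - v t).
  by move=> cu cv t; exact: cvgB (cu t) (cv t).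
have c1 i : continuous (fun t : T => (set_val t.1 : quat) ord0 i).
  by apply: sp1_coord_continuous => t; exact: cvg_fst.
have c2 i : continuous (fun t : T => (set_val t.2 : quat) ord0 i).
  by apply: sp1_coord_continuous => t; exact: cvg_snd.
have c i j : continuous (fun t : T =>
    (set_val t.1 : quat) ord0 i * (set_val t.2 : quat) ord0 j).
  by move=> t; exact: cvgM (c1 i t) (c2 j t).
apply: sp1_continuous; apply: mkquat_continuous.
- exact: (rB _ _ (rB _ _ (rB _ _ (c 0 0) (c 1 1)) (c 2%:R 2%:R)) (c 3%:R 3%:R)).
- exact: (rB _ _ (rD _ _ (rD _ _ (c 0 1) (c 1 0)) (c 2%:R 3%:R)) (c 3%:R 2%:R)).
- exact: (rD _ _ (rD _ _ (rB _ _ (c 0 2%:R) (c 1 3%:R)) (c 2%:R 0)) (c 3%:R 1)).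
- exact: (rD _ _ (rB _ _ (rD _ _ (c 0 3%:R) (c 1 2%:R)) (c 2%:R 1)) (c 3%:R 0)).
Qed.

Lemma sp1_inv_continuous : continuous (fun x : Sp1 => x^-1%g).
Proof.
have c i : continuous (fun x : Sp1 => (set_val x : quat) ord0 i).
  by apply: (@sp1_coord_continuous Sp1 id) => x; exact: cvg_id.
have cN i : continuous (fun x : Sp1 => - (set_val x : quat) ord0 i).
  by move=> x; exact: cvgN (c i x).
apply: sp1_continuous; apply: mkquat_continuous.
- exact: c.
- exact: (cN 1).
- exact: (cN 2%:R).
- exact: (cN 3%:R).
Qed.

HB.instance Definition _ :=
  Group_isTopological.Build Sp1 sp1_mul_continuous sp1_inv_continuous.

End quaternions.

(* Main.v *)
Require Import Defs.
From HB Require Import structures.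
From mathcomp Require Import all_boot all_order all_algebra generic_quotient.
From mathcomp Require Import complex ring lra.
From mathcomp Require Import all_classical all_reals all_analysis.

(** The action preserves the real part of a quaternion, hence the round
    two-spheres of constant real part, and it is the same rotation group on
    each of them.  So [Sp(1)/G] is the suspension of [S^2/G], and everything
    rests on a [G]-invariant map from [S^2] to [S^2] whose fibres are exactly
    the [G]-orbits.

    Such a map comes from the complex structure of [S^2].  Write
    [q = A(q) + B(q) j] with complex [A(q)] and [B(q)]; then [q |-> q^* i q]
    is the Hopf map, which identifies [S^2] with the projective line of ratios
    [B(q) / A(q)], and a rotation [v |-> m^* v m] becomes the projective map
    [q |-> q m].  Let [z] be the coordinate [B / A].  The map is the rational
    function [prod_(g in G) z(g v)] : it is visibly invariant and has degree
    [n].  In homogeneous form it is [formB / formA], where [formA q] and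
    [formB q] are the products of the [A(q m_g)] and of the [B(q m_g)].

    It is onto because the complex numbers are algebraically closed
    ([forms_surject]).  It separates orbits ([forms_separate]) for this reason.
    Restricted to an affine line, [formB] is a polynomial in [t] of degree at
    most [n], vanishing on the orbit of [t = 0].  Consider the product
    [prod_g (z(g t) - u)], which vanishes at [t = u], and clear its
    denominators.  Corrected by a multiple of [formA] so as to vanish at [0],
    the resulting polynomial vanishes on the whole orbit of [0] by invariance;
    if that orbit is free, it and [formB] have the same [n] roots and are
    proportional.  Hence the product depends only on the value of the rational
    function at [t], and vanishes wherever that value is the one taken at [u]:
    such a [t] lies in the orbit of [u].  This needs a coordinate system in
    which the orbit of [0] is free and avoids infinity, which is obtained by
    conjugating with a generic unit quaternion ([generic_conjugator]).

    In terms of [v = q^* i q] the squared norms of [formA] and [formB], and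
    their hermitian product, are products over [G] of affine functions of the
    coordinates of [g v]; so the map is given by explicit continuous formulas
    on [Sp(1)] ([orbit_map]), and no continuous section of the Hopf map is
    required.  A continuous bijection from a compact space to a Hausdorff space
    is a homeomorphism.

    The elements of [G] are abstract continuous automorphisms, so it must first
    be shown that they are rotations ([aut_inner]).  An automorphism [f] fixes
    [-1], so it preserves the set where the real part is zero, the solutions
    of [x^2 = -1]; by connectedness it preserves the sign of the real part.
    The signs of the real parts of [x], [x^2], [x^4], ... determine the real
    part of [x], which is therefore invariant.  So [f] is an isometry, and a
    quaternion intertwining [f] with the identity is found by the averaging
    argument of the Skolem-Noether theorem. *)

Set Implicit Arguments.
Unset Strict Implicit.
Unset Printing Implicit Defensive.

Import Order.TTheory GRing.Theory Num.Theory.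
Import numFieldNormedType.Exports.

Local Open Scope classical_set_scope.
Local Open Scope ring_scope.
Local Open Scope quotient_scope.
Local Open Scope complex_scope.

Local Notation Re := complex.Re.
Local Notation Im := complex.Im.
Local Notation "x ^*" := (conjc x) : ring_scope.

(** * Quaternions as an algebra, complex coordinates and the Hopf map *)

Section QuaternionAlgebra.
Variable R : realType.
Implicit Types p q z w : quat R.

HB.instance Definition _ := GRing.Lmodule.copy (quat R) 'rV[R]_4.

Lemma qreD p q : qre (p + q) = qre p + qre q. Proof. by rewrite /qre mxE. Qed.
Lemma qiD p q : qi (p + q) = qi p + qi q. Proof. by rewrite /qi mxE. Qed.
Lemma qjD p q : qj (p + q) = qj p + qj q. Proof. by rewrite /qj mxE. Qed.
Lemma qkD p q : qk (p + q) = qk p + qk q. Proof. by rewrite /qk mxE. Qed.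
Lemma qreN p : qre (- p) = - qre p. Proof. by rewrite /qre mxE. Qed.
Lemma qiN p : qi (- p) = - qi p. Proof. by rewrite /qi mxE. Qed.
Lemma qjN p : qj (- p) = - qj p. Proof. by rewrite /qj mxE. Qed.
Lemma qkN p : qk (- p) = - qk p. Proof. by rewrite /qk mxE. Qed.
Lemma qreZ (a : R) p : qre (a *: p) = a * qre p.
Proof. by rewrite /qre mxE. Qed.
Lemma qiZ (a : R) p : qi (a *: p) = a * qi p. Proof. by rewrite /qi mxE. Qed.
Lemma qjZ (a : R) p : qj (a *: p) = a * qj p. Proof. by rewrite /qj mxE. Qed.
Lemma qkZ (a : R) p : qk (a *: p) = a * qk p. Proof. by rewrite /qk mxE. Qed.
Lemma qre0 : qre (0 : quat R) = 0. Proof. by rewrite /qre mxE. Qed.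
Lemma qi0 : qi (0 : quat R) = 0. Proof. by rewrite /qi mxE. Qed.
Lemma qj0 : qj (0 : quat R) = 0. Proof. by rewrite /qj mxE. Qed.
Lemma qk0 : qk (0 : quat R) = 0. Proof. by rewrite /qk mxE. Qed.

Definition qlinE := (qreD, qiD, qjD, qkD, qreN, qiN, qjN, qkN,
  qreZ, qiZ, qjZ, qkZ, qre0, qi0, qj0, qk0).

Let q1 : quat R := mkquat 1 0 0 0.

Fact qmul1 : left_id q1 (@qmul R).
Proof. by move=> p; apply: quatP; rewrite /qmul !quatE; ring. Qed.
Fact qmulr1 : right_id q1 (@qmul R).
Proof. by move=> p; apply: quatP; rewrite /qmul !quatE; ring. Qed.
Fact qmulDl : left_distributive (@qmul R) +%R.
Proof. by move=> p q r; apply: quatP; rewrite !(qlinE, quatE); ring. Qed.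
Fact qmulDr : right_distributive (@qmul R) +%R.
Proof. by move=> p q r; apply: quatP; rewrite !(qlinE, quatE); ring. Qed.
Fact q1_neq0 : q1 != 0.
Proof.
apply/eqP => /(congr1 (@qre R)); rewrite !(qlinE, quatE).
exact/eqP/oner_neq0.
Qed.

HB.instance Definition _ := GRing.Zmodule_isNzRing.Build (quat R)
  (@qmulA R) qmul1 qmulr1 qmulDl qmulDr q1_neq0.

Fact qscaleAl (a : R) p q : a *: (p * q) = (a *: p) * q.
Proof. by apply: quatP; rewrite !(qlinE, quatE); ring. Qed.
HB.instance Definition _ := GRing.Lmodule_isLalgebra.Build R (quat R) qscaleAl.
Fact qscaleAr (a : R) p q : a *: (p * q) = p * (a *: q).
Proof. by apply: quatP; rewrite !(qlinE, quatE); ring. Qed.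
HB.instance Definition _ := GRing.Lalgebra_isAlgebra.Build R (quat R) qscaleAr.

Lemma qmulE p q : p * q = qmul p q. Proof. by []. Qed.
Lemma qoneE : 1 = mkquat 1 0 0 0 :> quat R. Proof. by []. Qed.

Lemma qreM p q :
  qre (p * q) = qre p * qre q - qi p * qi q - qj p * qj q - qk p * qk q.
Proof. exact: qreE. Qed.
Lemma qiM p q :
  qi (p * q) = qre p * qi q + qi p * qre q + qj p * qk q - qk p * qj q.
Proof. exact: qiE. Qed.
Lemma qjM p q :
  qj (p * q) = qre p * qj q - qi p * qk q + qj p * qre q + qk p * qi q.
Proof. exact: qjE. Qed.
Lemma qkM p q :
  qk (p * q) = qre p * qk q + qi p * qj q - qj p * qi q + qk p * qre q.
Proof. exact: qkE. Qed.
Lemma qreJ p : qre (qconj p) = qre p. Proof. exact: qreE. Qed.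
Lemma qiJ p : qi (qconj p) = - qi p. Proof. exact: qiE. Qed.
Lemma qjJ p : qj (qconj p) = - qj p. Proof. exact: qjE. Qed.
Lemma qkJ p : qk (qconj p) = - qk p. Proof. exact: qkE. Qed.

Definition qcoordE := (qlinE, qreM, qiM, qjM, qkM, qreJ, qiJ, qjJ, qkJ, quatE).

Lemma qconjM p q : qconj (p * q) = qconj q * qconj p.
Proof. by apply: quatP; rewrite !qcoordE; ring. Qed.
Lemma qconjZ (a : R) p : qconj (a *: p) = a *: qconj p.
Proof. by apply: quatP; rewrite !qcoordE; ring. Qed.
Lemma qconj1 : qconj 1 = 1.
Proof. by apply: quatP; rewrite !(qcoordE, qoneE) ?oppr0. Qed.
Lemma qconjK : involutive (@qconj R).
Proof. by move=> p; apply: quatP; rewrite !qcoordE ?opprK. Qed.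
Lemma mulqJ p : p * qconj p = (qnorm2 p)%:A.
Proof. by apply: quatP; rewrite !qcoordE /qnorm2; ring. Qed.
Lemma mulJq p : qconj p * p = (qnorm2 p)%:A.
Proof. by apply: quatP; rewrite !qcoordE /qnorm2; ring. Qed.
Lemma qnorm2J p : qnorm2 (qconj p) = qnorm2 p.
Proof. by rewrite /qnorm2 !qcoordE; ring. Qed.
Lemma qnorm2Z (a : R) p : qnorm2 (a *: p) = a ^+ 2 * qnorm2 p.
Proof. by rewrite /qnorm2 !qcoordE; ring. Qed.
Lemma qnorm2_ge0 p : 0 <= qnorm2 p.
Proof. by rewrite /qnorm2 !addr_ge0 ?sqr_ge0. Qed.
Lemma qnorm2_eq0 p : (qnorm2 p == 0) = (p == 0).
Proof.
apply/eqP/eqP => [|->]; last by rewrite /qnorm2 !qcoordE; ring.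
move/eqP; rewrite /qnorm2 !paddr_eq0 ?addr_ge0 ?sqr_ge0// !sqrf_eq0.
move=> /andP[/andP[/andP[/eqP ? /eqP ?] /eqP ?] /eqP ?].
by apply: quatP; rewrite !qcoordE.
Qed.
Lemma qnorm2_gt0 p : (0 < qnorm2 p) = (p != 0).
Proof. by rewrite lt_def qnorm2_eq0 qnorm2_ge0 andbT. Qed.
Lemma qunitJ p : qnorm2 p = 1 -> qconj p * p = 1.
Proof. by rewrite mulJq => ->; rewrite scale1r. Qed.
Lemma qunitJr p : qnorm2 p = 1 -> p * qconj p = 1.
Proof. by rewrite mulqJ => ->; rewrite scale1r. Qed.

(** The quaternion [q] is [qA q + qB q * j], with complex scalars acting on the
    left. *)
Definition qA p : R[i] := Complex (qre p) (qi p).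
Definition qB p : R[i] := Complex (qj p) (qk p).
Definition cpair (a b : R[i]) : quat R := mkquat (Re a) (Im a) (Re b) (Im b).

Lemma qAB_eq p q : qA p = qA q -> qB p = qB q -> p = q.
Proof. by move=> [? ?] [? ?]; exact: quatP. Qed.

Lemma complexP (x y : R[i]) : Re x = Re y -> Im x = Im y -> x = y.
Proof. by case: x y => [a b] [c d] /= -> ->. Qed.

Lemma qAM p q : qA (p * q) = qA p * qA q - qB p * (qB q)^*.
Proof.
by apply: complexP; rewrite /qA /qB; simpc; rewrite /= !qcoordE; ring.
Qed.
Lemma qBM p q : qB (p * q) = qA p * qB q + qB p * (qA q)^*.
Proof.
by apply: complexP; rewrite /qA /qB; simpc; rewrite /= !qcoordE; ring.
Qed.
Lemma qAJ p : qA (qconj p) = (qA p)^*.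
Proof. by rewrite /qA !qcoordE. Qed.
Lemma qBJ p : qB (qconj p) = - qB p.
Proof. by rewrite /qB !qcoordE; simpc. Qed.
Lemma qAN p : qA (- p) = - qA p.
Proof. by rewrite /qA !qcoordE; simpc. Qed.
Lemma qBN p : qB (- p) = - qB p.
Proof. by rewrite /qB !qcoordE; simpc. Qed.
Lemma qA_pair a b : qA (cpair a b) = a.
Proof. by apply: complexP; rewrite /qA /= !quatE. Qed.
Lemma qB_pair a b : qB (cpair a b) = b.
Proof. by apply: complexP; rewrite /qB /= !quatE. Qed.
Lemma qAB_eq0 p : qA p = 0 -> qB p = 0 -> p = 0.
Proof. by move=> [? ?] [? ?]; apply: quatP; rewrite !qcoordE. Qed.

Definition hopf p : quat R := qconj p * mkquat 0 1 0 0 * p.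

(** Vanishes exactly when [p] and [q] are proportional over the complex numbers;
    nonzero ones then define the same point of the projective line. *)
Definition qdet p q : R[i] := qA p * qB q - qB p * qA q.

Lemma qdetE p q : qdet p q = - qB (p * qconj q).
Proof. by rewrite qBM qAJ qBJ conjcK /qdet; ring. Qed.

Lemma qconj_i_complex l : qB l = 0 ->
  qconj l * mkquat 0 1 0 0 * l = qnorm2 l *: mkquat 0 1 0 0.
Proof.
by case=> j0 k0; apply: quatP; rewrite /qnorm2 !qcoordE j0 k0; ring.
Qed.

Lemma commute_i_complex l :
  mkquat 0 1 0 0 * l = l * mkquat 0 1 0 0 -> qB l = 0.
Proof.
move=> il; have := congr1 (@qj R) il; have := congr1 (@qk R) il.
by rewrite !qcoordE => k0 j0; apply: complexP => /=; lra.
Qed.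

(** If [p q^*] is a complex number [l] then [p] is a complex multiple of [q],
    and [l^* i l] is a real multiple of [i]. *)
Lemma hopf_qdet p q : qdet p q = 0 -> qnorm2 q *: hopf p = qnorm2 p *: hopf q.
Proof.
rewrite qdetE => /eqP; rewrite oppr_eq0 => /eqP.
set l := p * qconj q => l0.
have pE : qnorm2 q *: p = l * q by rewrite /l -mulrA mulJq -scalerAr mulr1.
have nl : qnorm2 l = qnorm2 q * qnorm2 p.
  by rewrite /l qmulE qnorm2M qnorm2J mulrC.
clearbody l.
have [q0|q0] := eqVneq (qnorm2 q) 0.
  move/eqP: q0; rewrite qnorm2_eq0 => /eqP ->.
  rewrite /hopf mulr0 scaler0 [X in X *: _](_ : _ = 0) ?scale0r//.
  by apply/eqP; rewrite qnorm2_eq0.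
apply: (scalerI q0); rewrite !scalerA -expr2.
have -> : qnorm2 q ^+ 2 *: hopf p = hopf (qnorm2 q *: p).
  by rewrite /hopf qconjZ -!scalerAl -scalerAr scalerA expr2.
rewrite pE /hopf qconjM -!mulrA (mulrA (mkquat _ _ _ _))
  !(mulrA (qconj l)) qconj_i_complex//.
by rewrite -!scalerAl -!scalerAr mulrA nl.
Qed.

(** Multiplying by [p] on the left and by [q^*] on the right turns the
    hypothesis into the commutation of [i] with [p q^*]. *)
Lemma qdet_hopf p q : p != 0 -> q != 0 ->
  qnorm2 q *: hopf p = qnorm2 p *: hopf q -> qdet p q = 0.
Proof.
move=> p0 q0 /(congr1 (fun x => p * x * qconj q)).
rewrite /hopf -!scalerAr -!scalerAl !mulrA mulqJ -!mulrA mulqJ.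
rewrite -!scalerAl mul1r -!scalerAr mulr1 !scalerA mulrC => /scalerI.
rewrite mulf_neq0 ?qnorm2_eq0// => /(_ isT).
rewrite mulrA qdetE => il.
by rewrite commute_i_complex ?oppr0// mulrA il mulrA.
Qed.

End QuaternionAlgebra.

(** * Invariant binary forms of a finite group of projective maps *)

Lemma prod_scale (C : comNzRingType) (I : Type) (s : seq I) (c : C)
    (F : I -> C) :
  \prod_(g <- s) (c * F g) = c ^+ size s * \prod_(g <- s) F g.
Proof.
elim: s => [|g s IH]; first by rewrite !big_nil expr0 mul1r.
by rewrite !big_cons IH /= exprS; ring.
Qed.

Section OrbitForms.
Variables (R : realType) (I : eqType) (s : seq I) (m : I -> quat R).
Local Notation C := (R[i]).
Implicit Types p q : quat R.

Definition formA q : C := \prod_(g <- s) qA (q * m g).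
Definition formB q : C := \prod_(g <- s) qB (q * m g).

(** The factor for [g] is the restriction of [al * qA + be * qB], composed with
    right multiplication by [m g], to the line of the quaternions [1 + t j]. *)
Definition orbit_factor (al be : C) (g : I) : {poly C} :=
  (al * qA (m g) + be * qB (m g))%:P
  + (be * (qA (m g))^* - al * (qB (m g))^*)%:P * 'X.

Definition orbit_poly (al be : C) : {poly C} :=
  \prod_(g <- s) orbit_factor al be g.

Lemma horner_orbit_poly al be (t : C) : (orbit_poly al be).[t] =
  \prod_(g <- s) (al * qA (cpair 1 t * m g) + be * qB (cpair 1 t * m g)).
Proof.
rewrite /orbit_poly horner_prod; apply: eq_bigr => g _.
by rewrite /orbit_factor !hornerE qAM qBM qA_pair qB_pair; ring.
Qed.

Lemma size_orbit_poly r al be :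
  (size (\prod_(g <- r) orbit_factor al be g)%R <= (size r).+1)%N.
Proof.
elim: r => [|g r IH]; first by rewrite big_nil size_poly1.
rewrite big_cons /=; apply: leq_trans (size_polyMleq _ _) _.
have s2 : (size (orbit_factor al be g) <= 2)%N.
  apply: leq_trans (size_polyD _ _) _.
  rewrite geq_max (leq_trans (size_polyC_leq1 _))//=.
  apply: leq_trans (size_polyMleq _ _) _.
  by rewrite size_polyX addn2 /= ltnS size_polyC_leq1.
by rewrite -subn1 leq_subLR add1n; exact: leq_add s2 IH.
Qed.

Lemma coef_orbit_poly r al be :
  (\prod_(g <- r) orbit_factor al be g)`_(size r) =
  \prod_(g <- r) (be * (qA (m g))^* - al * (qB (m g))^*).
Proof.
elim: r => [|g r IH]; first by rewrite !big_nil coef1.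
rewrite !big_cons /orbit_factor mulrDl coefD coefCM -mulrA coefCM coefXM /=.
by rewrite [_`_(size r).+1]nth_default ?size_orbit_poly// mulr0 add0r IH.
Qed.

Hypothesis uniq_s : uniq s.
Variable i0 : I.
Hypothesis i0s : i0 \in s.
Hypothesis mi0 : m i0 = 1.
(** For a finite projective group, the two separation conditions say that no
    two points of the orbit of [1], which has coordinate zero, are antipodal,
    and that this orbit is free. *)
Hypothesis sepA : forall k l, k \in s -> l \in s -> qA (qconj (m k) * m l) != 0.
Hypothesis sepB : forall k l, k \in s -> l \in s -> k != l ->
  qB (m k * qconj (m l)) != 0.
(** Unit quaternions represent rotations only up to sign, so that [m k * m g]
    is [m] of a product only up to sign; testing against odd functions and
    allowing a factor [e] absorbs the signs. *)
Hypothesis semi_invariant : forall k, k \in s -> exists e : C,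
  forall L : quat R -> C, (forall x, L (- x) = - L x) ->
  \prod_(g <- s) L (m k * m g) = e * \prod_(g <- s) L (m g).

Lemma orbit_qA_neq0 k : k \in s -> qA (m k) != 0.
Proof. by move=> ks; have := sepA i0s ks; rewrite mi0 qconj1 mul1r. Qed.

(** The coordinate of the image of [t = 0] under [m k]. *)
Definition orbit_root k : C := qB (m k) / qA (m k).

Lemma cpair_root k : k \in s ->
  cpair (qA (m k)) 0 * cpair 1 (orbit_root k) = m k.
Proof.
move=> /orbit_qA_neq0 k0; apply: qAB_eq.
  by rewrite qAM !qA_pair !qB_pair mul0r mulr1 subr0.
by rewrite qBM !qA_pair !qB_pair mul0r addr0 /orbit_root mulrC divfK.
Qed.

Lemma qA_cscale (a : C) q : qA (cpair a 0 * q) = a * qA q.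
Proof. by rewrite qAM qA_pair qB_pair mul0r subr0. Qed.
Lemma qB_cscale (a : C) q : qB (cpair a 0 * q) = a * qB q.
Proof. by rewrite qBM qA_pair qB_pair mul0r addr0. Qed.

Lemma cpair10 : cpair 1 0 = 1 :> quat R.
Proof. by apply: quatP; rewrite qoneE !quatE. Qed.

Lemma qA1 : qA 1 = 1 :> C. Proof. by rewrite -cpair10 qA_pair. Qed.
Lemma qB1 : qB 1 = 0 :> C. Proof. by rewrite -cpair10 qB_pair. Qed.

(** The factor [e] does not depend on [al] and [be]: two forms can be combined
    so that the combination vanishes at zero, and it then vanishes on the orbit
    of zero. *)
Lemma orbit_poly_root k : k \in s -> exists e : C, forall al be,
  (orbit_poly al be).[orbit_root k] = e * (orbit_poly al be).[0].
Proof.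
move=> ks; have [e eP] := semi_invariant ks.
exists (e / qA (m k) ^+ size s) => al be.
apply: (mulfI (expf_neq0 (size s) (orbit_qA_neq0 ks))).
rewrite mulrA [in RHS]mulrCA mulfV ?expf_neq0 ?orbit_qA_neq0// mulr1.
rewrite !horner_orbit_poly cpair10.
transitivity (\prod_(g <- s) (al * qA (m k * m g) + be * qB (m k * m g))).
  rewrite -prod_scale; apply: eq_bigr => g _.
  have -> : m k * m g = cpair (qA (m k)) 0 * (cpair 1 (orbit_root k) * m g).
    by rewrite mulrA cpair_root.
  by rewrite qA_cscale qB_cscale; ring.
rewrite (eP (fun x => al * qA x + be * qB x)) => [|x]; last first.
  by rewrite qAN qBN; ring.
by congr (_ * _); apply: eq_bigr => g _; rewrite mul1r.
Qed.

Lemma uniq_orbit_roots : uniq (map orbit_root s).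
Proof.
rewrite map_inj_in_uniq// => k l ks ls; rewrite /orbit_root => kl.
apply/eqP; apply: contraT => neq; move: (sepB ks ls neq).
rewrite qBM qBJ qAJ conjcK => /eqP[].
have ak := orbit_qA_neq0 ks; have al := orbit_qA_neq0 ls.
rewrite -(divfK ak (qB (m k))) kl.
rewrite -{1}(divfK al (qB (m l))); ring.
Qed.

Lemma poly_orbit_roots (p : {poly C}) : (size p <= (size s).+1)%N ->
  (forall k, k \in s -> p.[orbit_root k] = 0) ->
  exists c : C, p = c *: \prod_(z <- map orbit_root s) ('X - z%:P).
Proof.
move=> sp p0; have [->|pn0] := eqVneq p 0; first by exists 0; rewrite scale0r.
have ps : all (root p) (map orbit_root s).
  by apply/allP => _ /mapP[k ks ->]; apply/rootP/p0.
have us := uniq_orbit_roots.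
exists (lead_coef p); apply: all_roots_prod_XsubC => //; last first.
  by rewrite uniq_rootsE.
apply/eqP; rewrite eqn_leq size_map sp /=.
by have := max_poly_roots pn0 ps us; rewrite size_map.
Qed.

Lemma formA_line t : formA (cpair 1 t) = (orbit_poly 1 0).[t].
Proof.
by rewrite horner_orbit_poly; apply: eq_bigr => g _; rewrite mul1r mul0r addr0.
Qed.
Lemma formB_line t : formB (cpair 1 t) = (orbit_poly 0 1).[t].
Proof.
by rewrite horner_orbit_poly; apply: eq_bigr => g _; rewrite mul1r mul0r add0r.
Qed.

Lemma formA_cscale (a : C) q : formA (cpair a 0 * q) = a ^+ size s * formA q.
Proof.
by rewrite /formA -prod_scale; apply: eq_bigr => g _; rewrite -mulrA qA_cscale.
Qed.
Lemma formB_cscale (a : C) q : formB (cpair a 0 * q) = a ^+ size s * formB q.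
Proof.
by rewrite /formB -prod_scale; apply: eq_bigr => g _; rewrite -mulrA qB_cscale.
Qed.

(** A common zero would put two antipodal points in one orbit. *)
Lemma forms_no_common_zero q : q != 0 -> formA q = 0 -> formB q != 0.
Proof.
move=> q0 /eqP; rewrite prodf_seq_eq0 => /hasP[g gs /eqP Ag].
apply/negP; rewrite prodf_seq_eq0 => /hasP[h hs /eqP Bh].
have := sepA hs gs; have qq : qnorm2 q != 0 by rewrite qnorm2_eq0.
move/eqP; apply; have : qA (qconj (q * m h) * (q * m g)) = 0.
  by rewrite qAM qAJ Ag qBJ Bh; ring.
rewrite qconjM mulrA -(mulrA _ (qconj q)) mulJq -scalerAr mulr1 -scalerAl.
case; rewrite !qlinE => /eqP + /eqP; rewrite !mulf_eq0 !(negPf qq) /=.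
by move=> /eqP ? /eqP ?; exact: complexP.
Qed.

Lemma cpair_line q : qA q != 0 -> q = cpair (qA q) 0 * cpair 1 (qB q / qA q).
Proof.
move=> q0; apply: qAB_eq; first by rewrite qA_cscale qA_pair mulr1.
by rewrite qB_cscale qB_pair mulrC divfK.
Qed.

Lemma formA_neq0_qA q : formA q != 0 -> qA q != 0.
Proof.
apply: contra => /eqP A0; rewrite /formA prodf_seq_eq0; apply/hasP.
by exists i0 => //=; rewrite mi0 mulr1 A0.
Qed.

(** [orbit_poly (- u) 1] is the product of the differences between [u] and the
    images of [t], cleared of denominators.  Both it (corrected to vanish at
    zero) and [formB] are multiples of the product over the orbit of zero, so
    that it is a linear combination of [formA] and [formB] on the line; this
    combination is determined up to a factor by its vanishing at [u]. *)
Lemma orbit_poly_separates t u :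
  formB (cpair 1 u) != 0 ->
  formA (cpair 1 t) * formB (cpair 1 u) =
    formB (cpair 1 t) * formA (cpair 1 u) ->
  (orbit_poly (- u) 1).[t] = 0.
Proof.
rewrite !formA_line !formB_line.
set P := orbit_poly 1 0; set Q := orbit_poly 0 1; set A := orbit_poly (- u) 1.
move=> Qu PQ.
have P0 : P.[0] != 0.
  rewrite -formA_line cpair10 prodf_seq_neq0; apply/allP => g gs /=.
  by rewrite mul1r orbit_qA_neq0.
have Q0 : Q.[0] = 0.
  rewrite -formB_line cpair10; apply/eqP; rewrite prodf_seq_eq0; apply/hasP.
  by exists i0 => //=; rewrite mi0 mulr1 -cpair10 qB_pair.
have Au : A.[u] = 0.
  rewrite horner_orbit_poly; apply/eqP; rewrite prodf_seq_eq0; apply/hasP.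
  by exists i0 => //=; rewrite mi0 mulr1 qA_pair qB_pair; apply/eqP; ring.
have [cQ QE] : exists c : C, Q = c *: \prod_(z <- map orbit_root s) ('X - z%:P).
  apply: poly_orbit_roots => [|k ks]; first exact: size_orbit_poly.
  by have [e ->] := orbit_poly_root ks; rewrite -/Q Q0 mulr0.
have cQ0 : cQ != 0.
  by apply: contra Qu => /eqP c0; rewrite QE c0 scale0r horner0.
have [c cE] : exists c : C, P.[0] *: A - A.[0] *: P =
    c *: \prod_(z <- map orbit_root s) ('X - z%:P).
  apply: poly_orbit_roots => [|k ks].
    apply: leq_trans (size_polyD _ _) _; rewrite size_polyN geq_max.
    by rewrite !(leq_trans (size_scale_leq _ _)) ?size_orbit_poly.
  have [e eP] := orbit_poly_root ks.
  by rewrite hornerD hornerN !hornerZ !eP -/A -/P; ring.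
have key x : P.[0] * A.[x] - A.[0] * P.[x] = c / cQ * Q.[x].
  rewrite -!hornerZ -hornerN -hornerD cE QE !hornerZ mulrA divfK//.
have := key u; rewrite Au mulr0 sub0r => ku.
have /eqP := key t; rewrite subr_eq => /eqP kt.
apply: (mulfI P0); apply: (mulIf Qu); rewrite kt mulr0 mul0r mulrDl -!mulrA PQ.
by rewrite [Q.[t] * Q.[u]]mulrC !mulrA -ku; ring.
Qed.

(** Two points with the same ratio [formB / formA] have a common point in their
    orbits.  This point is [1] or [j] when the ratio is zero or infinite;
    otherwise it comes from a vanishing factor of the product considered in
    [orbit_poly_separates]. *)
Lemma forms_separate p q : p != 0 -> q != 0 ->
  formA p * formB q = formB p * formA q ->
  exists g h, [/\ g \in s, h \in s & qdet (p * m g) (q * m h) = 0].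
Proof.
move=> p0 q0 pq.
have nA x : formA x = 0 -> exists2 g, g \in s & qA (x * m g) = 0.
  by move=> /eqP; rewrite prodf_seq_eq0 => /hasP[g gs /eqP]; exists g.
have nB x : formB x = 0 -> exists2 g, g \in s & qB (x * m g) = 0.
  by move=> /eqP; rewrite prodf_seq_eq0 => /hasP[g gs /eqP]; exists g.
have dA g h : qA (p * m g) = 0 -> qA (q * m h) = 0 ->
    qdet (p * m g) (q * m h) = 0.
  by rewrite /qdet => -> ->; ring.
have dB g h : qB (p * m g) = 0 -> qB (q * m h) = 0 ->
    qdet (p * m g) (q * m h) = 0.
  by rewrite /qdet => -> ->; ring.
have [Bq|Bq] := eqVneq (formB q) 0.
  have Aq : formA q != 0.
    by apply: contraTneq isT => /(forms_no_common_zero q0); rewrite Bq eqxx.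
  have [h hs Bh] := nB _ Bq.
  have [g gs Bg] : exists2 g, g \in s & qB (p * m g) = 0.
    by apply: nB; apply/(mulIf Aq); rewrite -pq Bq mulr0 mul0r.
  by exists g, h; split=> //; exact: dB.
have [Ap|Ap] := eqVneq (formA p) 0.
  have [g gs Ag] := nA _ Ap; have Bp := forms_no_common_zero p0 Ap.
  have [h hs Ah] : exists2 h, h \in s & qA (q * m h) = 0.
    by apply: nA; apply/(mulfI Bp); rewrite -pq Ap mulr0 mul0r.
  by exists g, h; split=> //; exact: dA.
have Aq : formA q != 0.
  apply: contraTneq isT => Aq; move/eqP: pq; rewrite Aq mulr0 mulf_eq0.
  by rewrite (negPf Ap) (negPf Bq).
have ap := formA_neq0_qA Ap; have aq := formA_neq0_qA Aq.
set t := qB p / qA p; set u := qB q / qA q.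
have pE : p = cpair (qA p) 0 * cpair 1 t by exact: cpair_line.
have qE : q = cpair (qA q) 0 * cpair 1 u by exact: cpair_line.
have ap' := expf_neq0 (size s) ap; have aq' := expf_neq0 (size s) aq.
have : (orbit_poly (- u) 1).[t] = 0.
  apply: orbit_poly_separates.
    by move: Bq; rewrite {1}qE formB_cscale mulf_eq0 negb_or => /andP[].
  move: pq; rewrite pE qE !formA_cscale !formB_cscale => pq.
  by apply: (mulfI ap'); apply: (mulfI aq'); ring: pq.
rewrite horner_orbit_poly => /eqP; rewrite prodf_seq_eq0 => /hasP[g gs /eqP Eg].
exists g, i0; split=> //; rewrite mi0 mulr1 pE qE -mulrA /qdet.
rewrite !qA_cscale !qB_cscale qA_pair qB_pair.
have -> : qB (cpair 1 t * m g) = u * qA (cpair 1 t * m g).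
  by apply/eqP; rewrite -subr_eq0; apply/eqP; rewrite -Eg; ring.
ring.
Qed.

(** If [a] is nonzero, the equation on the affine line is polynomial of degree
    exactly [size s]: the top coefficient of [formA] contains the factor of
    [i0], which is zero, and that of [formB] is the conjugate of the product of
    the [qA (m g)].  If [a] is zero, the point at infinity is a solution. *)
Lemma forms_surject (a b : C) : (a != 0) || (b != 0) ->
  exists2 q, q != 0 & formA q * b = formB q * a.
Proof.
move=> ab.
have [a0|a0] := eqVneq a 0.
  exists (cpair 0 1).
    apply/eqP => /(congr1 (@qB R)); rewrite qB_pair => -[] /eqP.
    by rewrite !qcoordE oner_eq0.
  rewrite a0 mulr0 /formA (big_rem i0)//= mi0 mulr1 qA_pair; ring.
pose p := b *: orbit_poly 1 0 - a *: orbit_poly 0 1.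
have [t] : exists t : C, root p t.
  apply/closed_rootP/negP => /eqP p1; suff: p`_(size s) != 0.
    rewrite nth_default ?eqxx// p1 lt0n size_eq0.
    by apply: contraL i0s => /eqP ->.
  have -> : p`_(size s) = - (a * \prod_(g <- s) (qA (m g))^*).
    rewrite /p coefB !coefZ !coef_orbit_poly.
    have -> : \prod_(g <- s) (0 * (qA (m g))^* - 1 * (qB (m g))^*) = 0 :> C.
      apply/eqP; rewrite prodf_seq_eq0; apply/hasP; exists i0 => //.
      by rewrite mi0 qA1 qB1 conjc0; apply/eqP; ring.
    have -> : \prod_(g <- s) (1 * (qA (m g))^* - 0 * (qB (m g))^*) =
      \prod_(g <- s) (qA (m g))^* by apply: eq_bigr => g _; ring.
    ring.
  rewrite oppr_eq0 mulf_neq0// prodf_seq_neq0; apply/allP => g gs.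
  by apply/implyP => _; rewrite conjc_eq0 orbit_qA_neq0.
rewrite /root /p hornerD hornerN !hornerZ -formA_line -formB_line subr_eq0.
move=> /eqP pt; exists (cpair 1 t).
  apply/eqP => /(congr1 (@qA R)); rewrite qA_pair => -[] /eqP.
  by rewrite !qcoordE oner_eq0.
by rewrite mulrC pt mulrC.
Qed.
End OrbitForms.

(** * Angle doubling *)

Section DoublingItinerary.
Variable R : realType.
Implicit Types c x y : R.

Lemma acos_le_pihalf c : 0 <= c <= 1 -> acos c <= pi / 2.
Proof.
move=> /andP[c0 c1]; have c11 : -1 <= c <= 1 by rewrite c1 andbT; lra.
have p0 := pi_gt0 R; rewrite leNgt; apply/negP => lt.
have : cos (acos c) < cos (pi / 2).
  by rewrite ltr_cos // in_itv /= ?acos_ge0 ?acos_lepi//;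
    apply/andP; split; lra.
by rewrite acosK ?in_itv//= cos_pihalf ltNge c0.
Qed.

Lemma acos_double c : 0 <= c <= 1 -> acos (2 * c ^+ 2 - 1) = 2 * acos c.
Proof.
move=> c01; have c11 : -1 <= c <= 1.
  by case/andP: c01 => ? ->; rewrite andbT; lra.
rewrite -[in LHS](@acosK _ c) ?in_itv//= mulrC mulr_natr -cos_mulr2n cosK.
  by rewrite mulrC mulr_natr.
rewrite in_itv /= mulrn_wge0 ?acos_ge0//=.
by rewrite -mulr_natr; have := acos_le_pihalf c01; lra.
Qed.

Lemma acos_double_dist x y : -1 <= x <= 1 -> -1 <= y <= 1 ->
  (0 <= x /\ 0 <= y) \/ (x <= 0 /\ y <= 0) ->
  `|acos (2 * x ^+ 2 - 1) - acos (2 * y ^+ 2 - 1)| = 2 * `|acos x - acos y|.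
Proof.
move=> /[dup] x11 /andP[x1 x2] /[dup] y11 /andP[y1 y2] [[x0 y0]|[x0 y0]].
  rewrite !acos_double ?x0 ?y0// -mulrBr normrM ger0_norm//.
rewrite -(sqrrN x) -(sqrrN y) !acos_double; try by apply/andP; split; lra.
rewrite !acosN// -mulrBr normrM ger0_norm//; congr (_ * _).
by rewrite -normrN; congr (`|_|); lra.
Qed.

(** The angles of two points with the same signs keep doubling their distance,
    which would exceed [pi] if the points were different. *)
Lemma doubling_itinerary_inj (u v : nat -> R) :
  (forall n, u n.+1 = 2 * u n ^+ 2 - 1) ->
  (forall n, v n.+1 = 2 * v n ^+ 2 - 1) ->
  (forall n, -1 <= u n <= 1) -> (forall n, -1 <= v n <= 1) ->
  (forall n, (0 <= u n /\ 0 <= v n) \/ (u n <= 0 /\ v n <= 0)) ->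
  u 0 = v 0.
Proof.
move=> uS vS u1 v1 uv.
have dist n : `|acos (u n) - acos (v n)| = 2 ^+ n * `|acos (u 0) - acos (v 0)|.
  elim: n => [|n IH]; first by rewrite expr0 mul1r.
  by rewrite uS vS acos_double_dist// IH exprS mulrA.
suff acosE : acos (u 0) = acos (v 0).
  by rewrite -(@acosK _ (u 0)) ?in_itv//= acosE acosK// in_itv /=.
apply/eqP; rewrite -subr_eq0 -normr_le0 leNgt; apply/negP => d0.
set d := `|_| in d0 dist.
have bnd n : 2 ^+ n * d <= pi.
  rewrite -dist ler_norml.
  have := acos_ge0 (u1 n); have := acos_lepi (u1 n).
  have := acos_ge0 (v1 n); have := acos_lepi (v1 n).
  by move=> *; apply/andP; split; lra.
have [n nP] : exists n : nat, pi / d < n%:R.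
  by exists (Num.truncn (pi / d)).+1; apply: truncnS_gt.
have : pi < 2 ^+ n * d.
  rewrite -ltr_pdivrMr//; apply: lt_le_trans nP _.
  by rewrite -natrX ler_nat ltnW// ltn_expl.
by rewrite ltNge bnd.
Qed.
End DoublingItinerary.

(** * Continuity of quaternion-valued functions *)

Section QuaternionContinuity.
Variable R : realType.

Lemma quat_continuous (T : topologicalType) (F : T -> quat R) :
  continuous (fun t => qre (F t)) -> continuous (fun t => qi (F t)) ->
  continuous (fun t => qj (F t)) -> continuous (fun t => qk (F t)) ->
  continuous F.
Proof.
move=> c0 c1 c2 c3.
rewrite (_ : F = fun t => mkquat (qre (F t)) (qi (F t)) (qj (F t)) (qk (F t))).
  exact: mkquat_continuous.
by apply/funext => t; apply: quatP; rewrite quatE.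
Qed.

Section RealFunctions.
Variable T : topologicalType.
Implicit Types u v : T -> R.
Lemma cts_add u v : continuous u -> continuous v ->
  continuous (fun t => u t + v t).
Proof. by move=> cu cv t; exact: cvgD (cu t) (cv t). Qed.
Lemma cts_sub u v : continuous u -> continuous v ->
  continuous (fun t => u t - v t).
Proof. by move=> cu cv t; exact: cvgB (cu t) (cv t). Qed.
Lemma cts_mul u v : continuous u -> continuous v ->
  continuous (fun t => u t * v t).
Proof. by move=> cu cv t; exact: cvgM (cu t) (cv t). Qed.
Lemma cts_opp u : continuous u -> continuous (fun t => - u t).
Proof. by move=> cu t; exact: cvgN (cu t). Qed.
Lemma cts_cst (c : R) : continuous (fun _ : T => c).
Proof. by move=> t; exact: cvg_cst. Qed.
Lemma cts_sqrt u : continuous u -> continuous (fun t => Num.sqrt (u t)).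
Proof.
by move=> cu t; apply: continuous_comp (cu t) _; exact: sqrt_continuous.
Qed.
Lemma cts_inv u : (forall t, u t != 0) -> continuous u ->
  continuous (fun t => (u t)^-1).
Proof. by move=> u0 cu t; apply: cvgV (cu t). Qed.
End RealFunctions.

End QuaternionContinuity.

(** * Continuous automorphisms of Sp(1) are inner *)

Section Automorphisms.
Variable R : realType.
Local Notation S := (Sp1 R).
Local Notation "\q x" := (set_val x : quat R) (at level 10).

Lemma sp1_norm (x : S) : qnorm2 (\q x) = 1. Proof. exact: qnorm2_sp1. Qed.
Lemma sp1M (x y : S) : \q (x * y)%g = \q x * \q y. Proof. by []. Qed.
Lemma sp1V (x : S) : \q (x^-1)%g = qconj (\q x). Proof. by []. Qed.
Lemma sp1_val1 : \q (1%g : S) = 1. Proof. by []. Qed.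
Lemma sp1_inj : injective (fun x : S => \q x). Proof. exact: val_inj. Qed.

Lemma qsqr (p : quat R) : p * p = (2 * qre p) *: p - (qnorm2 p)%:A.
Proof. by apply: quatP; rewrite /qnorm2 !(qcoordE, qoneE); ring. Qed.

Lemma quat_sqr_eq1 (p : quat R) : p * p = 1 -> p = 1 \/ p = - 1.
Proof.
move=> pp; have : qnorm2 ((p - 1) * (p + 1)) = 0.
  apply/eqP; rewrite qnorm2_eq0 mulrDr mulr1 mulrBl pp mul1r addrA subrK.
  by rewrite subrr.
rewrite qmulE qnorm2M => /eqP; rewrite mulf_eq0 !qnorm2_eq0 subr_eq0 addr_eq0.
by move=> /orP[]/eqP; [left|right].
Qed.

Lemma qre2_le (p : quat R) : qre p ^+ 2 <= qnorm2 p.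
Proof. by rewrite /qnorm2 -!addrA lerDl !addr_ge0 ?sqr_ge0. Qed.

Lemma sp1_re_bound (x : S) : -1 <= qre (\q x) <= 1.
Proof.
by have := qre2_le (\q x); rewrite sp1_norm => h; apply/andP; split; nra.
Qed.

Fact neg_oneP : qnorm2 (- 1 : quat R) = 1.
Proof. by rewrite /qnorm2 !(qcoordE, qoneE); ring. Qed.
Fact qunit_i : qnorm2 (mkquat 0 1 0 0 : quat R) = 1.
Proof. by rewrite /qnorm2 !quatE; ring. Qed.
Fact qunit_j : qnorm2 (mkquat 0 0 1 0 : quat R) = 1.
Proof. by rewrite /qnorm2 !quatE; ring. Qed.
Definition sp1_neg1 : S := to_sp1 neg_oneP.

Variable f : topAut S.

Let fM (x y : S) : f (x * y)%g = (f x * f y)%g.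
Proof. by have [fM _] := autP f; exact: fM. Qed.

Let f_cont : continuous f.
Proof. by have [_ [g []]] := autP f. Qed.

Let f_inj : injective f.
Proof. by have [_ [g [fK _ _ _]]] := autP f; exact: can_inj fK. Qed.

Let f1 : f 1%g = 1%g.
Proof. by apply: (mulgI (f 1%g)); rewrite -fM !mulg1. Qed.

Let fV x : f (x^-1)%g = (f x)^-1%g.
Proof. by apply: (mulgI (f x)); rewrite -fM !mulgV f1. Qed.

Let fN1 : f sp1_neg1 = sp1_neg1.
Proof.
have sq : \q (f sp1_neg1) * \q (f sp1_neg1) = 1.
  rewrite -sp1M -fM -sp1_val1 -f1; congr (\q (f _)); apply: sp1_inj.
  by rewrite sp1M sp1_val1 /= mulrNN mulr1.
have [e|e] := quat_sqr_eq1 sq; last exact: sp1_inj.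
have /f_inj : f sp1_neg1 = f 1%g by rewrite f1; exact: sp1_inj.
move=> /(congr1 (fun x : S => qre (\q x))).
by rewrite /= !(qcoordE, qoneE) => h; exfalso; clear sq e; lra.
Qed.

Lemma aut_opp (x : S) : \q (f (sp1_neg1 * x)%g) = - \q (f x).
Proof. by rewrite fM fN1 sp1M /= mulN1r. Qed.

Lemma sp1_qre_eq0 (x : S) : qre (\q x) = 0 <-> (x * x)%g = sp1_neg1.
Proof.
split=> [x0|/(congr1 (fun x : S => qre (\q x)))].
  by apply: sp1_inj; rewrite sp1M qsqr x0 mulr0 scale0r sub0r sp1_norm scale1r.
rewrite sp1M qsqr sp1_norm /= !(qcoordE, qoneE) => h.
by apply/eqP; rewrite -sqrf_eq0; apply/eqP; lra.
Qed.

(** The pure unit quaternions are the square roots of [-1]. *)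
Lemma aut_qre_eq0 (x : S) : qre (\q (f x)) = 0 <-> qre (\q x) = 0.
Proof.
rewrite !sp1_qre_eq0 -fM -[in X in X <-> _]fN1.
by split=> [/f_inj|->].
Qed.

(* Normalizing the chord from 1 to [x] gives a path on the sphere; its squared
   norm is bounded below when [x] has positive real part. *)
Let chord (x : S) (t : R) : quat R := (1 - t)%:A + t *: \q x.

Let qnorm2_chord x t :
  qnorm2 (chord x t) = 1 - 2 * (t * (1 - t)) * (1 - qre (\q x)).
Proof.
have := sp1_norm x; rewrite /chord /qnorm2 !(qcoordE, qoneE).
set a := qre _; set b := qi _; set c := qj _; set d := qk _ => E.
have d2 : d ^+ 2 = 1 - a ^+ 2 - b ^+ 2 - c ^+ 2 by lra.
by ring: d2.
Qed.

Let qnorm2_chord_gt0 x t : 0 < qre (\q x) -> 0 < qnorm2 (chord x t).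
Proof.
move=> x0; rewrite qnorm2_chord; have /andP[_ x1] := sp1_re_bound x.
have : t * (1 - t) <= 1 / 4 by have := sqr_ge0 (t - 1 / 2); nra.
nra.
Qed.

(** Along a path from [1] to [x] with positive real part, the real part of the
    image does not vanish, so it keeps its sign by the intermediate value
    theorem. *)
Lemma aut_qre_gt0 (x : S) : 0 < qre (\q x) -> 0 < qre (\q (f x)).
Proof.
move=> x0.
have ne0 t := qnorm2_chord_gt0 t x0.
have unitP t : qnorm2 ((Num.sqrt (qnorm2 (chord x t)))^-1 *: chord x t) = 1.
  rewrite qnorm2Z exprVn sqr_sqrtr; last exact: ltW.
  by rewrite mulVf// gt_eqF.
pose path t : S := to_sp1 (unitP t).
have path0 : path 0 = 1%g.
  apply: sp1_inj; change ((Num.sqrt (qnorm2 (chord x 0)))^-1 *: chord x 0 = 1).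
  rewrite qnorm2_chord mul0r mulr0 mul0r subr0 sqrtr1 invr1.
  by rewrite /chord scale0r subr0 scale1r addr0 scale1r.
have path1 : path 1 = x.
  apply: sp1_inj.
  change ((Num.sqrt (qnorm2 (chord x 1)))^-1 *: chord x 1 = \q x).
  rewrite qnorm2_chord subrr !mulr0 mul0r subr0 sqrtr1 invr1.
  by rewrite /chord subrr scale0r scale1r add0r scale1r.
have path_cont : continuous path.
  have idc : continuous (fun t : R => t) by move=> t; exact: cvg_id.
  have subc : continuous (fun t : R => 1 - t).
    by apply: cts_sub => //; exact: cts_cst.
  have inv_cont : continuous (fun t => (Num.sqrt (qnorm2 (chord x t)))^-1).
    apply: cts_inv => [t|]; first by rewrite sqrtr_eq0 -ltNge.
    apply: cts_sqrt.
    rewrite (_ : (fun t => _) =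
        fun t => 1 - 2 * (t * (1 - t)) * (1 - qre (\q x))).
      apply: cts_sub; first exact: cts_cst.
      apply: cts_mul; last exact: cts_cst.
      apply: cts_mul; first exact: cts_cst.
      exact: cts_mul.
    by apply/funext => t; rewrite qnorm2_chord.
  have comp_cont (a b : R) :
      continuous (fun t =>
        (Num.sqrt (qnorm2 (chord x t)))^-1 * ((1 - t) * a + t * b)).
    apply: cts_mul => //; apply: cts_add; apply: cts_mul => //.
      exact: cts_cst.
    exact: cts_cst.
  apply: sp1_continuous; apply: quat_continuous.
  - under eq_fun do rewrite /= qreZ /chord qreD !qreZ; exact: comp_cont.
  - under eq_fun do rewrite /= qiZ /chord qiD !qiZ; exact: comp_cont.
  - under eq_fun do rewrite /= qjZ /chord qjD !qjZ; exact: comp_cont.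
  - under eq_fun do rewrite /= qkZ /chord qkD !qkZ; exact: comp_cont.
rewrite ltNge; apply/negP => fx0.
have gcont : continuous (fun t => qre (\q (f (path t)))).
  have := @sp1_coord_continuous R _ (f \o path) 0; apply.
  by move=> t; apply: continuous_comp; [exact: path_cont|exact: f_cont].
have [|||t t01 /aut_qre_eq0] := @IVT R (fun t => qre (\q (f (path t)))) 0 1 0.
- exact: ler01.
- exact: continuous_subspaceT.
- rewrite path0 path1 f1 (_ : qre (\q (1%g : S)) = 1); last exact: qreE.
  by rewrite ge_min le_max fx0 ler01 orbT.
change (qre ((Num.sqrt (qnorm2 (chord x t)))^-1 *: chord x t) = 0 -> False).
rewrite qreZ /chord !(qcoordE, qoneE) => /eqP.
rewrite mulf_eq0 invr_eq0 sqrtr_eq0 leNgt ne0 /= => /eqP.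
move: t01; rewrite in_itv /= => /andP[t0 t1]; nra.
Qed.

Lemma aut_qre_ge0 (x : S) : 0 <= qre (\q x) -> 0 <= qre (\q (f x)).
Proof.
rewrite le_eqVlt => /orP[/eqP/esym/aut_qre_eq0->//|/aut_qre_gt0/ltW//].
Qed.

Lemma aut_qre_le0 (x : S) : qre (\q x) <= 0 -> qre (\q (f x)) <= 0.
Proof.
move=> x0; have := @aut_qre_ge0 (sp1_neg1 * x)%g.
by rewrite aut_opp sp1M /= mulN1r !qreN !oppr_ge0; apply.
Qed.

Let pow2 (x : S) n : S := iter n (fun y => y * y)%g x.

Let qre_pow2S x n : qre (\q (pow2 x n.+1)) = 2 * qre (\q (pow2 x n)) ^+ 2 - 1.
Proof.
have -> : \q (pow2 x n.+1) = \q (pow2 x n) * \q (pow2 x n) by [].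
by rewrite qsqr sp1_norm !(qcoordE, qoneE); ring.
Qed.

Let aut_pow2 x n : f (pow2 x n) = pow2 (f x) n.
Proof. by elim: n => //= n <-; exact: fM. Qed.

(** The real part of the square [x * x] is [2 * qre x ^+ 2 - 1], so that
    repeated squaring makes the real part follow the doubling map. *)
Lemma aut_qre (x : S) : qre (\q (f x)) = qre (\q x).
Proof.
apply: (@doubling_itinerary_inj R (fun n => qre (\q (pow2 (f x) n)))
  (fun n => qre (\q (pow2 x n)))) => n; rewrite -?aut_pow2.
- by rewrite !aut_pow2 qre_pow2S.
- exact: qre_pow2S.
- exact: sp1_re_bound.
- exact: sp1_re_bound.
- have [x0|x0] := leP 0 (qre (\q (pow2 x n))); [left|right].
    by split=> //; exact: aut_qre_ge0.
  by split; [exact/aut_qre_le0/ltW|exact: ltW].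
Qed.

Definition qdot (p q : quat R) : R := qre (p * qconj q).

Lemma qdot_1 p : qdot p 1 = qre p.
Proof. by rewrite /qdot !(qcoordE, qoneE); ring. Qed.
Lemma qdot_i p : qdot p (mkquat 0 1 0 0) = qi p.
Proof. by rewrite /qdot !(qcoordE, qoneE); ring. Qed.
Lemma qdot_j p : qdot p (mkquat 0 0 1 0) = qj p.
Proof. by rewrite /qdot !(qcoordE, qoneE); ring. Qed.
Lemma qdot_k p : qdot p (mkquat 0 0 0 1) = qk p.
Proof. by rewrite /qdot !(qcoordE, qoneE); ring. Qed.
Lemma qre_cyclic (p q : quat R) : qre (p * q) = qre (q * p).
Proof. by rewrite !qcoordE; ring. Qed.

Lemma qdot_conjugate (p u v : quat R) :
  qdot (qconj p * u * p) v = qdot u (p * v * qconj p).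
Proof. by rewrite /qdot !qconjM qconjK -!mulrA [LHS]qre_cyclic -!mulrA. Qed.

(** The values of this expression at [1], [i], [j], [k], multiplied on the right
    by the conjugates of these elements, add up to [4]. *)
Lemma intertwiner_neq0 (I J K : quat R) : exists a : quat R,
  a - I * a * mkquat 0 1 0 0 - J * a * mkquat 0 0 1 0
    - K * a * mkquat 0 0 0 1 != 0.
Proof.
apply: contrapT => h.
have w0 a : a - I * a * mkquat 0 1 0 0 - J * a * mkquat 0 0 1 0
    - K * a * mkquat 0 0 0 1 = 0.
  by apply/eqP/negPn/negP => wa; apply: h; exists a.
have := congr1 (@qre R) (w0 1); have := congr1 (@qi R) (w0 (mkquat 0 1 0 0)).
have := congr1 (@qj R) (w0 (mkquat 0 0 1 0)).
have := congr1 (@qk R) (w0 (mkquat 0 0 0 1)).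
clear w0; rewrite !(qcoordE, qoneE); lra.
Qed.

Lemma aut_qdot (x y : S) : qdot (\q (f x)) (\q (f y)) = qdot (\q x) (\q y).
Proof. by rewrite /qdot -!sp1V -!sp1M -fV -fM aut_qre. Qed.

Let ui : S := to_sp1 qunit_i.
Let uj : S := to_sp1 qunit_j.
Local Notation qI := (mkquat 0 1 0 0 : quat R).
Local Notation qJ := (mkquat 0 0 1 0 : quat R).
Local Notation qK := (mkquat 0 0 0 1 : quat R).

Let fu (u : S) : \q u * \q u = - 1 -> \q (f u) * \q (f u) = - 1.
Proof.
move=> uu; rewrite -sp1M -fM (_ : (u * u)%g = sp1_neg1) ?fN1//.
exact: sp1_inj.
Qed.

(** With [I], [J] the images of [i], [j], the sum [w a] of the [f(e) a e^-1]
    over [e] in [1, i, j, k] satisfies [I * w a = w a * i] and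
    [J * w a = w a * j]; normalized, it conjugates [i], [j], [k] into their
    images.  As [f] is isometric, it agrees with this conjugation wherever the
    inner products with the images of [1], [i], [j], [k] agree. *)
Lemma aut_inner : exists2 p : quat R, qnorm2 p = 1 &
  forall x : S, \q (f x) = qconj p * \q x * p.
Proof.
set I := \q (f ui); set J := \q (f uj).
have ii : qI * qI = - 1 by apply: quatP; rewrite !(qcoordE, qoneE); ring.
have jj : qJ * qJ = - 1 by apply: quatP; rewrite !(qcoordE, qoneE); ring.
have ij : qI * qJ = qK by apply: quatP; rewrite !(qcoordE, qoneE); ring.
have ji : qJ * qI = - qK by apply: quatP; rewrite !(qcoordE, qoneE); ring.
have ki : qK * qI = qJ by apply: quatP; rewrite !(qcoordE, qoneE); ring.
have kj : qK * qJ = - qI by apply: quatP; rewrite !(qcoordE, qoneE); ring.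
have II : I * I = - 1 by exact: fu.
have JJ : J * J = - 1 by exact: fu.
have JI : J * I = - (I * J).
  rewrite /I /J -!sp1M -!fM -aut_opp; congr (\q (f _)).
  by apply: sp1_inj; rewrite !sp1M /= mulN1r ij ji.
pose w a := a - I * a * qI - J * a * qJ - I * J * a * qK.
have Iw a : I * w a = w a * qI.
  rewrite /w !mulrBr !mulrBl.
  have -> : I * (I * a * qI) = - (a * qI) by rewrite !mulrA II !mulN1r mulNr.
  have -> : I * (I * J * a * qK) = - (J * a * qK).
    by rewrite !mulrA II !mulNr mul1r.
  rewrite -(mulrA _ qI qI) ii -(mulrA _ qJ qI) ji -(mulrA _ qK qI) ki.
  rewrite !mulrN mulr1 !mulrA !opprK [I * a + _]addrC -!addrA.
  by congr (_ + (_ + _)); rewrite addrC.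
have Jw a : J * w a = w a * qJ.
  rewrite /w !mulrBr !mulrBl.
  have -> : J * (J * a * qJ) = - (a * qJ) by rewrite !mulrA JJ !mulN1r mulNr.
  have -> : J * (I * a * qI) = - (I * J * a * qI) by rewrite !mulrA JI !mulNr.
  have -> : J * (I * J * a * qK) = I * a * qK.
    by rewrite !mulrA JI !mulNr -(mulrA I J J) JJ mulrN1 !mulNr opprK.
  rewrite -(mulrA _ qI qJ) ij -(mulrA _ qJ qJ) jj -(mulrA _ qK qJ) kj.
  rewrite !mulrN mulr1 ?mulrA !opprK.
  by rewrite -addrA addrC addrA.
have [a wa] : exists a, w a != 0 := intertwiner_neq0 I J (I * J).
pose p := (Num.sqrt (qnorm2 (w a)))^-1 *: w a.
have p1 : qnorm2 p = 1.
  rewrite qnorm2Z exprVn sqr_sqrtr ?qnorm2_ge0//.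
  by rewrite mulVf// qnorm2_eq0.
have Ip : I = p * qI * qconj p.
  by rewrite /p -scalerAl -Iw scalerAr -/p -mulrA qunitJr// mulr1.
have Jp : J = p * qJ * qconj p.
  by rewrite /p -scalerAl -Jw scalerAr -/p -mulrA qunitJr// mulr1.
exists (qconj p); first by rewrite qnorm2J.
move=> x; rewrite qconjK.
suff <- : qconj p * \q (f x) * p = \q x.
  by rewrite !mulrA qunitJr// mul1r -mulrA qunitJr// mulr1.
have dot_e (e : S) : \q (f e) = p * \q e * qconj p ->
    qdot (qconj p * \q (f x) * p) (\q e) = qdot (\q x) (\q e).
  by move=> fe; rewrite qdot_conjugate -fe aut_qdot.
have d1 := dot_e 1%g; have di := dot_e ui Ip; have dj := dot_e uj Jp.
have dk : qdot (qconj p * \q (f x) * p) qK = qdot (\q x) qK.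
  have -> : qK = \q (ui * uj)%g by rewrite sp1M /= ij.
  apply: dot_e; rewrite fM !sp1M -/I -/J Ip Jp !mulrA.
  by rewrite -(mulrA (p * qI)) qunitJ// mulr1.
move: di dj dk {dot_e}; rewrite /= !qdot_i !qdot_j !qdot_k => di dj dk.
have := d1 _; rewrite sp1_val1 !qdot_1 f1 mulr1 qunitJr// => /(_ erefl) d0.
exact: quatP.
Qed.

End Automorphisms.

(** * Surjectivity of the Hopf map and generic coordinates *)

Section Generic.
Variable R : realType.
Implicit Types p q v c : quat R.

(** The quaternion [h i + v] conjugates [h i] into [v], as both have square
    [- h ^+ 2]; when it vanishes, [v] is [- h i] and [j] does. *)
Lemma hopf_lift (h : R) v : qre v = 0 -> qnorm2 v = h ^+ 2 ->
  exists2 q, q != 0 & h *: hopf q = qnorm2 q *: v.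
Proof.
move=> v0 vh; pose q : quat R := mkquat 0 h 0 0 + v.
have [q0|q0] := eqVneq q 0.
  exists (mkquat 0 0 1 0).
    by apply/eqP => /(congr1 (@qj R)) /eqP; rewrite !qcoordE oner_eq0.
  have -> : v = mkquat 0 (- h) 0 0.
    rewrite -[v](addKr (mkquat 0 h 0 0)) -/q q0.
    by apply: quatP; rewrite !qcoordE ?oppr0 ?addr0.
  by apply: quatP; rewrite /hopf /qnorm2 !qcoordE; ring.
exists q => //.
have hq : h *: (mkquat 0 1 0 0 * q) = q * v.
  have : h ^+ 2 = qi v ^+ 2 + qj v ^+ 2 + qk v ^+ 2.
    by rewrite -vh /qnorm2 v0; ring.
  by move=> h2; apply: quatP; rewrite /q !qcoordE v0; ring: h2.
by rewrite /hopf -mulrA scalerAr hq mulrA mulJq -scalerAl mul1r.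
Qed.

Lemma poly_nonroot (p : {poly R}) : p != 0 -> exists x, p.[x] != 0.
Proof.
move=> p0; apply: contrapT => h.
have pr x : root p x by apply/negPn/negP => px; apply: h; exists x.
have := @max_poly_roots _ p [seq i%:R | i <- iota 0 (size p)] p0.
rewrite size_map size_iota ltnn => H; suff : false by [].
apply: H; first by apply/allP.
by rewrite map_inj_uniq ?iota_uniq// => i j /eqP; rewrite eqr_nat => /eqP.
Qed.

(** The curve [(1, t, t^2)] meets each plane through the origin at most twice,
    so it leaves any finite set of planes and lines. *)
Lemma generic_direction (ps : seq (quat R)) :
  exists t : R, forall p, p \in ps ->
  p <> (qre p)%:A ->
  qdot p (mkquat 0 1 t (t ^+ 2)) != 0 /\
  p * mkquat 0 1 t (t ^+ 2) != mkquat 0 1 t (t ^+ 2) * p.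
Proof.
pose c1 p : {poly R} := (qi p)%:P + (qj p)%:P * 'X + (qk p)%:P * 'X^2.
(* Up to sign, the last coordinate of the cross product of [p] with (1, t, t^2).
   It is identically zero when the imaginary part of [p] lies on the last axis,
   but then the middle coordinate is the constant [qk p]. *)
pose c2 p : {poly R} :=
  if (qi p == 0) && (qj p == 0) then 1 else (qj p)%:P - (qi p)%:P * 'X.
pose pp p := if p == (qre p)%:A then 1 else c1 p * c2 p.
have pp0 p : pp p != 0.
  rewrite /pp; case: (p =P (qre p)%:A) => [_|pn]; first exact: oner_neq0.
  apply: mulf_neq0; last first.
    rewrite /c2; case: ifPn => [_|]; first exact: oner_neq0.
    apply: contra => /eqP c20; apply/andP; split; apply/eqP.
      have /(congr1 (fun r : {poly R} => r`_1)) := c20.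
      rewrite coefB coefC coefMX coefC coef0 /= sub0r => /eqP.
      by rewrite oppr_eq0 => /eqP.
    have /(congr1 (fun r : {poly R} => r`_0)) := c20.
    by rewrite coefB coefC coefMX coef0 /= subr0.
  apply: contra_notN pn => /eqP c10.
  have e i : (c1 p)`_i = 0 by rewrite c10 coef0.
  have := e 0; have := e 1; have := e 2.
  rewrite /c1 !coefD !coefC !coefMX !coefMXn !coefC /= !add0r !addr0.
  move=> k0 j0 i0.
  by apply: quatP; rewrite !(qcoordE, qoneE) ?mulr1 ?mulr0.
have [t] : exists t, (\prod_(p <- ps) pp p).[t] != 0.
  apply: poly_nonroot; rewrite prodf_seq_neq0; apply/allP => p _.
  by apply/implyP => _; exact: pp0.
rewrite horner_prod prodf_seq_neq0 => /allP ht; exists t => p pps pn.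
have := ht p pps; rewrite /= /pp; case: (p =P (qre p)%:A) => // _.
rewrite hornerM mulf_eq0 negb_or => /andP[h1 h2]; split.
  suff -> : qdot p (mkquat 0 1 t (t ^+ 2)) = (c1 p).[t] by [].
  rewrite /c1 !(hornerD, hornerM, hornerC, hornerX, hornerXn).
  by rewrite /qdot !qcoordE; ring.
apply: contra h2 => /eqP comm.
have ej := congr1 (@qj R) comm; have ek := congr1 (@qk R) comm.
move: ej ek; rewrite !qcoordE => ej ek.
rewrite /c2; case: ifPn => [/andP[/eqP i0 /eqP j0]|_]; last first.
  by rewrite !hornerE; apply/eqP; clear comm; lra.
case: pn; apply: quatP; rewrite !(qcoordE, qoneE) ?mulr1 ?mulr0//.
by clear comm; move: ej ek; rewrite i0 j0; lra.
Qed.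

(** Take for [c i c^*] a generic direction: the [i]-coordinate of [c^* p c] is
    the inner product of [p] with it, and [qB (c^* p c)] is zero only when [p]
    commutes with it. *)
Lemma generic_conjugator (ps : seq (quat R)) : exists2 c, qnorm2 c = 1 &
  forall p, p \in ps -> p != 0 ->
  qA (qconj c * p * c) != 0 /\ (qB (qconj c * p * c) = 0 -> p = (qre p)%:A).
Proof.
have [t tP] := generic_direction ps.
pose al : quat R := mkquat 0 1 t (t ^+ 2).
have al0 : 0 < qnorm2 al.
  rewrite qnorm2_gt0; apply/eqP => /(congr1 (@qi R)) /eqP.
  by rewrite !qcoordE oner_eq0.
have [|q q0 qP] := @hopf_lift (Num.sqrt (qnorm2 al)) al (qreE _ _ _ _).
  by rewrite sqr_sqrtr// ltW.
have qn0 : qnorm2 q != 0 by rewrite qnorm2_eq0.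
set h := Num.sqrt (qnorm2 al) in qP.
have h0 : h != 0 by rewrite gt_eqF// sqrtr_gt0.
pose c := (Num.sqrt (qnorm2 q))^-1 *: qconj q.
have c1 : qnorm2 c = 1.
  by rewrite qnorm2Z qnorm2J exprVn sqr_sqrtr ?qnorm2_ge0// mulVf.
have cic : c * mkquat 0 1 0 0 * qconj c = h^-1 *: al.
  have -> : c * mkquat 0 1 0 0 * qconj c = (qnorm2 q)^-1 *: hopf q.
    rewrite /c qconjZ qconjK -!scalerAl -scalerAr scalerA -expr2 exprVn.
    by rewrite sqr_sqrtr ?qnorm2_ge0.
  apply: (scalerI h0); rewrite [RHS]scalerA mulfV// scale1r scalerA mulrC.
  by rewrite -scalerA qP scalerA mulVf// scale1r.
clearbody c; exists c => // p pps p0.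
have [pr|/eqP pn] := eqVneq p (qre p)%:A.
  have r0 : qre p != 0 by apply: contra p0 => /eqP r0; rewrite pr r0 scale0r.
  have -> : qconj c * p * c = p.
    by rewrite [in LHS]pr -scalerAr mulr1 -scalerAl qunitJ// -pr.
  by split=> // ; apply: contra r0 => /eqP[->].
have [dn cn] := tP p pps pn; split.
  apply/eqP => -[_] /eqP; rewrite -qdot_i qdot_conjugate cic.
  rewrite /qdot qconjZ -scalerAr qreZ mulf_eq0 invr_eq0 (negPf h0) /=.
  exact/negP.
move=> B0; move: cn => /negP[]; apply/eqP.
set l := qconj c * p * c in B0.
have pE : p = c * l * qconj c.
  by rewrite /l !mulrA qunitJr// mul1r -mulrA qunitJr// mulr1.
clearbody l.
have il : mkquat 0 1 0 0 * l = l * mkquat 0 1 0 0.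
  by case: B0 => j0 k0; apply: quatP; rewrite !qcoordE j0 k0; ring.
have : (c * mkquat 0 1 0 0 * qconj c) * p = p * (c * mkquat 0 1 0 0 * qconj c).
  rewrite pE !mulrA -(mulrA _ (qconj c) c) qunitJ// mulr1.
  by rewrite -(mulrA _ (qconj c) c) qunitJ// mulr1 -(mulrA c) il !mulrA.
by rewrite cic -scalerAl -scalerAr => /scalerI; rewrite invr_eq0 h0 => /(_ isT).
Qed.
End Generic.

(** * Unit quaternions representing the automorphisms *)

Section Lifts.
Variable R : realType.
Local Notation S := (Sp1 R).
Implicit Types f g k : topAut S.

(** A representative is unique only up to sign; with [1] for the identity, the
    identity contributes the plain coordinates [qA] and [qB] to the forms. *)
Definition aut_lift f : quat R :=
  if f == 1%g then 1 else s2val (cid2 (aut_inner f)).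

Lemma aut_lift1 : aut_lift 1%g = 1.
Proof. by rewrite /aut_lift eqxx. Qed.

Lemma qnorm2_1 : qnorm2 (1 : quat R) = 1.
Proof. by rewrite /qnorm2 !(qcoordE, qoneE); ring. Qed.

Lemma qnorm2_lift f : qnorm2 (aut_lift f) = 1.
Proof.
rewrite /aut_lift; case: eqP => _; first exact: qnorm2_1.
exact: (s2valP (cid2 (aut_inner f))).
Qed.

Lemma aut_liftE f (x : S) :
  set_val (f x) = qconj (aut_lift f) * (set_val x : quat R) * aut_lift f.
Proof.
rewrite /aut_lift; case: eqP => [->|_]; first by rewrite qconj1 mul1r mulr1.
exact: (s2valP' (cid2 (aut_inner f))).
Qed.

(** The quotient [p q^*] commutes with [i] and [j], hence is real. *)
Lemma lift_unique (p q : quat R) : qnorm2 p = 1 -> qnorm2 q = 1 ->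
  (forall x : S, qconj p * (set_val x : quat R) * p =
    qconj q * (set_val x : quat R) * q) ->
  p = q \/ p = - q.
Proof.
move=> p1 q1 pq; pose l := p * qconj q.
have comm (x : S) : (set_val x : quat R) * l = l * (set_val x : quat R).
  have := congr1 (fun z => p * z * qconj q) (pq x).
  rewrite /= !mulrA qunitJr// mul1r -!mulrA qunitJr// mulr1.
  by rewrite /l !mulrA.
have l1 : qnorm2 l = 1 by rewrite /l qmulE qnorm2M qnorm2J p1 q1 mulr1.
have pE : p = l * q by rewrite /l -mulrA qunitJ// mulr1.
clearbody l.
have := congr1 (@qj R) (comm (to_sp1 (qunit_i R))).
have := congr1 (@qk R) (comm (to_sp1 (qunit_i R))).
have := congr1 (@qk R) (comm (to_sp1 (qunit_j R))).
rewrite /= !qcoordE => ei ek ej.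
have i0 : qi l = 0 by clear comm pE pq; lra.
have j0 : qj l = 0 by clear comm pE pq; lra.
have k0 : qk l = 0 by clear comm pE pq; lra.
have lr : l = (qre l)%:A.
  by apply: quatP; rewrite !(qcoordE, qoneE) ?mulr1 ?mulr0.
have : qre l ^+ 2 = 1 by rewrite -l1 /qnorm2 i0 j0 k0; ring.
move/eqP; rewrite sqrf_eq1 => /orP[]/eqP e; rewrite pE lr e.
  by left; rewrite scale1r mul1r.
by right; rewrite scaleN1r mulN1r.
Qed.

Lemma aut_lift_mul k g : aut_lift k * aut_lift g = aut_lift (g * k)%g \/
  aut_lift k * aut_lift g = - aut_lift (g * k)%g.
Proof.
apply: lift_unique; rewrite ?qnorm2_lift//.
  by rewrite qmulE qnorm2M !qnorm2_lift mulr1.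
move=> x; rewrite -aut_liftE (_ : ((g * k)%g : topAut S) x = g (k x))//.
by rewrite !aut_liftE qconjM !mulrA.
Qed.

Lemma aut_lift_inj f g :
  aut_lift f = aut_lift g \/ aut_lift f = - aut_lift g -> f = g.
Proof.
move=> fg; apply: aut_inj => x; apply: sp1_inj; rewrite /= !aut_liftE.
case: fg => ->//; rewrite -scaleN1r qconjZ -!scalerAl -scalerAr scalerA.
by rewrite mulrNN mulr1 scale1r.
Qed.

Variables (G : groupClosed (topAut S)) (s : seq (topAut S)).
Hypothesis uniq_s : uniq s.
Hypothesis mem_s : forall f, (f \in s) = (f \in G).

Lemma perm_mulr k : k \in s -> perm_eq [seq (g * k)%g | g <- s] s.
Proof.
move=> ks; have us : uniq [seq (g * k)%g | g <- s].
  by rewrite map_inj_uniq//; exact: mulIg.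
apply: uniq_perm => // f; apply/mapP/idP => [[g gs ->]|fs].
  by move: gs ks; rewrite !mem_s => gs ks; exact: gpredM.
exists (f * k^-1)%g; last by rewrite mulgVK.
by move: fs ks; rewrite !mem_s => fs ks; rewrite gpredM ?gpredV.
Qed.

Variable c : quat R.
Hypothesis c1 : qnorm2 c = 1.

Definition conj_lift f : quat R := qconj c * aut_lift f * c.

Lemma conj_lift1 : conj_lift 1%g = 1.
Proof. by rewrite /conj_lift aut_lift1 mulr1 qunitJ. Qed.

Lemma qnorm2_conj_lift f : qnorm2 (conj_lift f) = 1.
Proof. by rewrite /conj_lift !qmulE !qnorm2M qnorm2J c1 qnorm2_lift !mulr1. Qed.

Lemma conj_liftM k g :
  conj_lift k * conj_lift g = qconj c * (aut_lift k * aut_lift g) * c.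
Proof. by rewrite /conj_lift !mulrA -(mulrA _ c (qconj c)) qunitJr// mulr1. Qed.

(** Right translation by [k] permutes the group, and the signs of the
    representatives are collected in [e]. *)
Lemma conj_lift_semi_invariant k : k \in s -> exists e : R[i],
  forall L : quat R -> R[i], (forall x, L (- x) = - L x) ->
  \prod_(g <- s) L (conj_lift k * conj_lift g) =
    e * \prod_(g <- s) L (conj_lift g).
Proof.
move=> ks; pose e g : R[i] :=
  if aut_lift k * aut_lift g == aut_lift (g * k)%g then 1 else -1.
exists (\prod_(g <- s) e g) => L Lodd.
rewrite -[\prod_(g <- s) L (conj_lift g)](perm_big _ (perm_mulr ks)).
rewrite big_map -big_split /=; apply: eq_bigr => g _; rewrite conj_liftM /e.
case: eqP => [->|ne]; first by rewrite mul1r.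
by case: (aut_lift_mul k g) => // ->; rewrite mulrN mulNr Lodd mulN1r.
Qed.

Lemma aut_lift_real_eq k l :
  aut_lift k * qconj (aut_lift l) =
    (qre (aut_lift k * qconj (aut_lift l)))%:A -> k = l.
Proof.
move: (qre _) => r pr; apply: aut_lift_inj.
have kE : aut_lift k = r *: aut_lift l.
  have := congr1 (fun z => z * aut_lift l) pr.
  by rewrite /= -mulrA qunitJ ?qnorm2_lift// mulr1 -scalerAl mul1r.
have : r ^+ 2 = 1.
  by have := qnorm2_lift k; rewrite kE qnorm2Z qnorm2_lift mulr1.
move/eqP; rewrite sqrf_eq1 kE => /orP[/eqP ->|/eqP ->].
  by left; rewrite scale1r.
by right; rewrite scaleN1r.
Qed.
End Lifts.

(** These are the separation conditions under which the forms built on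
    [conj_lift c] classify the orbits. *)
Lemma generic_conj_lift (R : realType) (s : seq (topAut (Sp1 R))) :
  exists2 c : quat R, qnorm2 c = 1 & forall k l, k \in s -> l \in s ->
    qA (qconj (conj_lift c k) * conj_lift c l) != 0 /\
    (k != l -> qB (conj_lift c k * qconj (conj_lift c l)) != 0).
Proof.
pose ps := [seq qconj (aut_lift k) * aut_lift l | k <- s, l <- s] ++
  [seq aut_lift k * qconj (aut_lift l) | k <- s, l <- s].
have [c c1 cP] := generic_conjugator ps; exists c => // k l ks ls.
have ne0 (p q : quat R) : qnorm2 p = 1 -> qnorm2 q = 1 -> p * q != 0.
  by move=> p1 q1; rewrite -qnorm2_eq0 qmulE qnorm2M p1 q1 mulr1 oner_neq0.
have cc a b : qconj c * a * c * (qconj c * b * c) = qconj c * (a * b) * c.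
  by rewrite !mulrA -(mulrA _ c (qconj c)) qunitJr// mulr1.
have cJ a : qconj (qconj c * a * c) = qconj c * qconj a * c.
  by rewrite !qconjM qconjK mulrA.
split=> [|kl].
  rewrite /conj_lift cJ cc.
  apply: (cP _ _ _).1; last by rewrite ne0 ?qnorm2J ?qnorm2_lift.
  by rewrite mem_cat; apply/orP; left; apply/allpairsP; exists (k, l).
rewrite /conj_lift cJ cc; apply: contra kl => /eqP B0.
apply/eqP/aut_lift_real_eq.
apply: (cP _ _ _).2 => //; last by rewrite ne0 ?qnorm2J ?qnorm2_lift.
by rewrite mem_cat; apply/orP; right; apply/allpairsP; exists (k, l).
Qed.

(** * The orbit map *)

Section OrbitMap.
Variables (R : realType) (s : seq (topAut (Sp1 R))) (c : quat R).
Local Notation S := (Sp1 R).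
Local Notation C := (R[i]).
Local Notation "\q x" := (set_val x : quat R) (at level 10).
Local Notation m := (conj_lift c).
Local Notation Psi q := (cpair (formA s m q) (formB s m q)).
Hypothesis c1 : qnorm2 c = 1.
Implicit Types (x : S) (f : topAut S).

(** The norm of the imaginary part of [x], i.e. the radius of the two-sphere of
    quaternions with the same real part. *)
Definition height x : R := Num.sqrt (1 - qre (\q x) ^+ 2).
Definition conj_aut f x : quat R := qconj c * \q (f x) * c.

(** If [c^* x c] has imaginary direction [q^* i q] then, up to a common factor,
    these products are [|formA q|^2], [|formB q|^2] and
    [(formA q)^* * formB q], the quantities that enter the Hopf map at
    [formA q + formB q * j]; but they are defined without choosing [q]. *)
Definition orbit_AA x : R := \prod_(f <- s) (height x + qi (conj_aut f x)).
Definition orbit_BB x : R := \prod_(f <- s) (height x - qi (conj_aut f x)).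
Definition orbit_AB x : C :=
  \prod_(f <- s) Complex (qk (conj_aut f x)) (- qj (conj_aut f x)).

(** The same real part as [x], and the direction given by the invariant rational
    function.  At [1] and [-1] there is no direction, but [d] is zero. *)
Definition orbit_map x : quat R :=
  let d := height x / (orbit_AA x + orbit_BB x) in
  mkquat (qre (\q x)) (d * (orbit_AA x - orbit_BB x))
    (d * (- 2 * Im (orbit_AB x))) (d * (2 * Re (orbit_AB x))).

Lemma height_ge0 x : 0 <= height x. Proof. exact: sqrtr_ge0. Qed.

Lemma sqr_height x : height x ^+ 2 = 1 - qre (\q x) ^+ 2.
Proof.
rewrite sqr_sqrtr// subr_ge0; have := qre2_le (\q x).
by rewrite sp1_norm.
Qed.

Definition axis_part x : quat R := qconj c * \q x * c - (qre (\q x))%:A.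

Lemma qre_conjugate (p : quat R) : qre (qconj c * p * c) = qre p.
Proof. by rewrite -mulrA qre_cyclic -mulrA qunitJr// mulr1. Qed.

Lemma axis_part_re x : qre (axis_part x) = 0.
Proof.
rewrite /axis_part qreD qreN qre_conjugate.
by rewrite !(qcoordE, qoneE) mulr1 subrr.
Qed.

Lemma qnorm2_sub_re (p : quat R) :
  qnorm2 (p - (qre p)%:A) = qnorm2 p - qre p ^+ 2.
Proof. by rewrite /qnorm2 !(qcoordE, qoneE); ring. Qed.

Lemma axis_part_norm x : qnorm2 (axis_part x) = height x ^+ 2.
Proof.
rewrite /axis_part -(qre_conjugate (\q x)) qnorm2_sub_re sqr_height.
rewrite qre_conjugate.
by rewrite !qmulE !qnorm2M qnorm2J c1 sp1_norm !mulr1.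
Qed.

(** [q] lies over the imaginary direction of [c^* x c]; the equation is
    homogeneous in [q], so that [q] need not be a unit. *)
Definition hopf_over (q : quat R) x : Prop :=
  q != 0 /\ height x *: hopf q = qnorm2 q *: axis_part x.

Lemma hopf_over_ex x : exists q, hopf_over q x.
Proof.
by have [q q0 qP] := hopf_lift (axis_part_re x) (axis_part_norm x); exists q.
Qed.

Lemma hopfM (p q : quat R) : hopf (p * q) = qconj q * hopf p * q.
Proof. by rewrite /hopf qconjM !mulrA. Qed.

Lemma conj_aut_axisE f x :
  conj_aut f x = (qre (\q x))%:A + qconj (m f) * axis_part x * m f.
Proof.
rewrite /conj_aut /axis_part aut_liftE mulrBr mulrBl -scalerAr mulr1 -scalerAl.
rewrite qunitJ ?qnorm2_conj_lift// addrCA subrr addr0.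
rewrite /conj_lift !qconjM qconjK !mulrA.
by rewrite -!(mulrA _ c (qconj c)) qunitJr// !mulr1.
Qed.

Lemma conj_aut_lift q f x : hopf_over q x ->
  conj_aut f x = (qre (\q x))%:A + (height x / qnorm2 q) *: hopf (q * m f).
Proof.
move=> [q0 qP]; rewrite conj_aut_axisE hopfM; congr (_ + _).
have qn0 : qnorm2 q != 0 by rewrite qnorm2_eq0.
rewrite (_ : axis_part x = (height x / qnorm2 q) *: hopf q).
  by rewrite -scalerAr -scalerAl.
by rewrite mulrC -scalerA qP scalerA mulVf// scale1r.
Qed.

Lemma hopf_re (q : quat R) : qre (hopf q) = 0.
Proof. by rewrite /hopf !qcoordE; ring. Qed.
Lemma hopf_AA (q : quat R) :
  (qnorm2 q + qi (hopf q))%:C = 2%:R * ((qA q)^* * qA q) :> C.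
Proof.
by rewrite /qnorm2 /hopf /qA !qcoordE; apply: complexP => /=; ring.
Qed.
Lemma hopf_BB (q : quat R) :
  (qnorm2 q - qi (hopf q))%:C = 2%:R * ((qB q)^* * qB q) :> C.
Proof.
by rewrite /qnorm2 /hopf /qB !qcoordE; apply: complexP => /=; ring.
Qed.
Lemma hopf_AB (q : quat R) :
  Complex (qk (hopf q)) (- qj (hopf q)) = 2%:R * ((qA q)^* * qB q) :> C.
Proof.
by rewrite /hopf /qA /qB !qcoordE; apply: complexP => /=; ring.
Qed.

Lemma qi_scalarD (a t : R) (w : quat R) : qi (a%:A + t *: w) = t * qi w.
Proof. by rewrite qiD !qiZ qoneE qiE mulr0 add0r. Qed.
Lemma qj_scalarD (a t : R) (w : quat R) : qj (a%:A + t *: w) = t * qj w.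
Proof. by rewrite qjD !qjZ qoneE qjE mulr0 add0r. Qed.
Lemma qk_scalarD (a t : R) (w : quat R) : qk (a%:A + t *: w) = t * qk w.
Proof. by rewrite qkD !qkZ qoneE qkE mulr0 add0r. Qed.

Let kappa (q : quat R) x : R := 2 * height x / qnorm2 q.

Let qnorm2_conj_lift_mul (q : quat R) f : qnorm2 (q * m f) = qnorm2 q.
Proof. by rewrite qmulE qnorm2M qnorm2_conj_lift// mulr1. Qed.

Let factor_scale (k : R) (F H : topAut S -> C) :
  \prod_(f <- s) (k%:C * ((F f)^* * H f)) =
  (k ^+ size s)%:C * ((\prod_(f <- s) F f)^* * \prod_(f <- s) H f).
Proof. by rewrite prod_scale rmorphXn big_split rmorph_prod. Qed.

Lemma orbit_AA_lift q x : hopf_over q x ->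
  (orbit_AA x)%:C = (kappa q x ^+ size s)%:C * ((formA s m q)^* * formA s m q).
Proof.
move=> qx; have qn0 : qnorm2 q != 0 by case: qx => ? _; rewrite qnorm2_eq0.
rewrite /formA -factor_scale /orbit_AA rmorph_prod; apply: eq_bigr => f _.
rewrite (conj_aut_lift f qx) qi_scalarD.
rewrite [RHS](_ : _ = (height x / qnorm2 q)%:C *
    (2%:R * ((qA (q * m f))^* * qA (q * m f)))); last first.
  by rewrite /kappa -(mulrA 2) rmorphM; ring.
rewrite -hopf_AA qnorm2_conj_lift_mul -rmorphM; congr (_ %:C).
by rewrite mulrDr divfK.
Qed.

Lemma orbit_BB_lift q x : hopf_over q x ->
  (orbit_BB x)%:C = (kappa q x ^+ size s)%:C * ((formB s m q)^* * formB s m q).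
Proof.
move=> qx; have qn0 : qnorm2 q != 0 by case: qx => ? _; rewrite qnorm2_eq0.
rewrite /formB -factor_scale /orbit_BB rmorph_prod; apply: eq_bigr => f _.
rewrite (conj_aut_lift f qx) qi_scalarD.
rewrite [RHS](_ : _ = (height x / qnorm2 q)%:C *
    (2%:R * ((qB (q * m f))^* * qB (q * m f)))); last first.
  by rewrite /kappa -(mulrA 2) rmorphM; ring.
rewrite -hopf_BB qnorm2_conj_lift_mul -rmorphM; congr (_ %:C).
by rewrite mulrBr divfK.
Qed.

Lemma orbit_AB_lift q x : hopf_over q x ->
  orbit_AB x = (kappa q x ^+ size s)%:C * ((formA s m q)^* * formB s m q).
Proof.
move=> qx; rewrite /formA /formB -factor_scale /orbit_AB.
apply: eq_bigr => f _.
rewrite (conj_aut_lift f qx) qj_scalarD qk_scalarD.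
rewrite [RHS](_ : _ = (height x / qnorm2 q)%:C *
    (2%:R * ((qA (q * m f))^* * qB (q * m f)))); last first.
  by rewrite /kappa -(mulrA 2) rmorphM; ring.
by rewrite -hopf_AB; apply: complexP => /=; ring.
Qed.

Lemma orbit_map_lift q x : hopf_over q x -> Psi q != 0 ->
  orbit_map x = (qre (\q x))%:A + (height x / qnorm2 (Psi q)) *: hopf (Psi q).
Proof.
move=> qx psi0; have := orbit_AB_lift qx.
have := orbit_BB_lift qx; have := orbit_AA_lift qx.
have qn0 : qnorm2 q != 0 by case: qx => ? _; rewrite qnorm2_eq0.
move: psi0; rewrite -qnorm2_eq0.
case: (formA s m q) => a b; case: (formB s m q) => d e.
set w := kappa q x ^+ size s.
move=> psi0 /(congr1 (@complex.Re R)) /= UE /(congr1 (@complex.Re R)) /= VE ME.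
have MR := congr1 (@complex.Re R) ME; have MI := congr1 (@complex.Im R) ME.
rewrite /= in MR MI.
have [h0|h0] := eqVneq (height x) 0.
  rewrite /orbit_map h0 !mul0r scale0r addr0.
  by apply: quatP; rewrite !(qcoordE, qoneE) ?mulr1 ?mulr0.
have w0 : w != 0.
  by rewrite expf_neq0// /kappa mulf_neq0 ?invr_neq0// mulf_neq0// pnatr_eq0.
move: psi0; rewrite /qnorm2 /cpair !quatE /= => psi0.
rewrite /orbit_map MR MI UE VE.
have wd : w * (a * a - - b * b) + w * (d * d - - e * e) != 0.
  rewrite (_ : _ + _ = w * (a ^+ 2 + b ^+ 2 + d ^+ 2 + e ^+ 2)); last by ring.
  exact: mulf_neq0.
by apply: quatP; rewrite /hopf !(qcoordE, qoneE); field; rewrite ?psi0 ?wd.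
Qed.

Lemma qnorm2_hopf (q : quat R) : qnorm2 (hopf q) = qnorm2 q ^+ 2.
Proof. by rewrite /hopf !qmulE !qnorm2M qnorm2J qunit_i mulr1 expr2. Qed.

Lemma qnorm2_scalarD (a t : R) (w : quat R) : qre w = 0 ->
  qnorm2 (a%:A + t *: w) = a ^+ 2 + t ^+ 2 * qnorm2 w.
Proof. by move=> w0; rewrite /qnorm2 !(qcoordE, qoneE) w0; ring. Qed.

Variable G : groupClosed (topAut S).
Hypothesis uniq_s : uniq s.
Hypothesis mem_s : forall f, (f \in s) = (f \in G).
Hypothesis sep : forall k l, k \in s -> l \in s ->
  qA (qconj (m k) * m l) != 0 /\ (k != l -> qB (m k * qconj (m l)) != 0).

Let one_s : 1%g \in s. Proof. by rewrite mem_s; exact: gpred1. Qed.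
Let m1 : m 1%g = 1. Proof. exact: conj_lift1. Qed.
Let sepA k l (ks : k \in s) (ls : l \in s) := (sep ks ls).1.
Let sepB k l (ks : k \in s) (ls : l \in s) := (sep ks ls).2.
Let semi := conj_lift_semi_invariant uniq_s mem_s c1.

Lemma Psi_neq0 (q : quat R) : q != 0 -> Psi q != 0.
Proof.
move=> q0; apply/eqP => P0.
have A0 : formA s m q = 0.
  by rewrite -(qA_pair (formA s m q) (formB s m q)) P0 /qA !qcoordE.
have B0 : formB s m q = 0.
  by rewrite -(qB_pair (formA s m q) (formB s m q)) P0 /qB !qcoordE.
by have := forms_no_common_zero sepA q0 A0; rewrite B0 eqxx.
Qed.

Lemma orbit_mapE q x : hopf_over q x ->
  orbit_map x = (qre (\q x))%:A + (height x / qnorm2 (Psi q)) *: hopf (Psi q).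
Proof. by move=> qx; apply: orbit_map_lift => //; case: qx => /Psi_neq0. Qed.

Lemma orbit_map_unit x : qnorm2 (orbit_map x) = 1.
Proof.
have [q qx] := hopf_over_ex x; rewrite (orbit_mapE qx).
rewrite qnorm2_scalarD ?hopf_re// qnorm2_hopf.
have P0 : qnorm2 (Psi q) != 0 by rewrite qnorm2_eq0 Psi_neq0//; case: qx.
by rewrite -exprMn divfK// sqr_height addrC subrK.
Qed.

(** At height zero [x] and [y] are [1] or [-1].  Otherwise equal images mean
    proportional pairs of forms, hence proportional points [q m_g] and [p m_h]
    in the orbits, whose Hopf images are [g x] and [h y]. *)
Lemma orbit_map_inj x y : orbit_map x = orbit_map y ->
  exists g h : topAut S, [/\ g \in s, h \in s & g x = h y].
Proof.
have [q qx] := hopf_over_ex x; have [p py] := hopf_over_ex y.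
have [q0 _] := qx; have [p0 _] := py.
have Pq := Psi_neq0 q0; have Pp := Psi_neq0 p0.
rewrite (orbit_mapE qx) (orbit_mapE py) => E.
have rexy : qre (\q x) = qre (\q y).
  have := congr1 (@qre R) E.
  by rewrite !(qreD, qreZ) !hopf_re !mulr0 !addr0 qoneE qreE !mulr1.
have hxy : height x = height y by rewrite /height rexy.
have [h0|h0] := eqVneq (height x) 0.
  exists 1%g, 1%g; split=> //; rewrite /=; apply: sp1_inj.
  have ax z : height z = 0 -> \q z = (qre (\q z))%:A.
    move=> z0; have := axis_part_norm z; rewrite z0 expr0n /= => /eqP.
    rewrite qnorm2_eq0 subr_eq0 => /eqP cz.
    have : \q z = c * (qconj c * \q z * c) * qconj c.
      by rewrite !mulrA qunitJr// mul1r -mulrA qunitJr// mulr1.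
    by rewrite cz -scalerAr mulr1 -scalerAl qunitJr.
  by rewrite (ax x h0) (ax y) -?hxy// rexy.
have : qdet (Psi q) (Psi p) = 0.
  apply: qdet_hopf => //.
  move/eqP: E; rewrite rexy hxy (inj_eq (addrI _)) => /eqP.
  move/(congr1 (fun z => (qnorm2 (Psi q) * qnorm2 (Psi p) / height y) *: z)).
  rewrite !scalerA -hxy.
  have nq : qnorm2 (Psi q) != 0 by rewrite qnorm2_eq0.
  have np : qnorm2 (Psi p) != 0 by rewrite qnorm2_eq0.
  move: (qnorm2 (Psi q)) (qnorm2 (Psi p)) nq np => a b na nb.
  rewrite (_ : a * b / height x * (height x / a) = b); last first.
    by field; rewrite ?na ?h0.
  rewrite (_ : a * b / height x * (height x / b) = a); last first.
    by field; rewrite ?nb ?h0.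
  by [].
rewrite /qdet !qA_pair !qB_pair => /eqP; rewrite subr_eq0 => /eqP pq.
have [g [h [gs hs ]]] := forms_separate uniq_s one_s m1 sepA sepB semi q0 p0 pq.
move=> /hopf_qdet; rewrite !qnorm2_conj_lift_mul => gh.
exists g, h; split=> //; apply: sp1_inj.
have nq : qnorm2 q != 0 by rewrite qnorm2_eq0.
have np : qnorm2 p != 0 by rewrite qnorm2_eq0.
have : conj_aut g x = conj_aut h y.
  rewrite (conj_aut_lift g qx) (conj_aut_lift h py) rexy hxy; congr (_ + _).
  apply: (scalerI (mulf_neq0 nq np)); rewrite !scalerA.
  move/(congr1 (fun z => height y *: z)): gh; rewrite !scalerA.
  move: (qnorm2 q) (qnorm2 p) nq np => a b na nb.
  rewrite (_ : a * b * (height y / a) = height y * b); last by field.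
  by rewrite (_ : a * b * (height y / b) = height y * a); last by field.
move/(congr1 (fun z => c * z * qconj c)).
rewrite /conj_aut !mulrA qunitJr// !mul1r.
by rewrite -!mulrA qunitJr// !mulr1.
Qed.

(** Lift the direction of [w] to [r], solve for [q] with forms proportional to
    [r], and take the point over which [q] lies with the real part of [w]. *)
Lemma orbit_map_surj (w : quat R) : qnorm2 w = 1 -> exists x, orbit_map x = w.
Proof.
move=> w1; pose v := w - (qre w)%:A; pose h := Num.sqrt (1 - qre w ^+ 2).
have h2 : h ^+ 2 = 1 - qre w ^+ 2 by rewrite sqr_sqrtr// subr_ge0 -w1 qre2_le.
have v0 : qre v = 0 by rewrite /v qreD qreN !(qcoordE, qoneE) mulr1 subrr.
have vh : qnorm2 v = h ^+ 2 by rewrite /v qnorm2_sub_re w1 h2.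
have [r r0 rv] := hopf_lift v0 vh.
have [|q q0 qr] := @forms_surject _ _ s m 1%g one_s m1 sepA (qA r) (qB r).
  rewrite -negb_and; apply: contra r0 => /andP[/eqP a0 /eqP b0].
  exact/eqP/qAB_eq0.
have Pq := Psi_neq0 q0.
have nq : qnorm2 q != 0 by rewrite qnorm2_eq0.
have nr : qnorm2 r != 0 by rewrite qnorm2_eq0.
have nP : qnorm2 (Psi q) != 0 by rewrite qnorm2_eq0.
pose z : quat R := (qre w)%:A + (h / qnorm2 q) *: hopf q.
have z1 : qnorm2 (c * z * qconj c) = 1.
  rewrite !qmulE !qnorm2M qnorm2J c1 mulr1 mul1r qnorm2_scalarD ?hopf_re//.
  by rewrite qnorm2_hopf -exprMn divfK// h2 addrC subrK.
pose x := to_sp1 z1; exists x.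
have rex : qre (\q x) = qre w.
  have -> : \q x = c * z * qconj c by [].
  rewrite -mulrA qre_cyclic -mulrA qunitJ// mulr1 /z qreD !qreZ hopf_re.
  by rewrite mulr0 addr0 qoneE qreE mulr1.
have cxc : qconj c * \q x * c = z.
  have -> : \q x = c * z * qconj c by [].
  by rewrite !mulrA qunitJ// mul1r -mulrA qunitJ// mulr1.
have hx : height x = h by rewrite /height rex.
have qx : hopf_over q x.
  split=> //; rewrite /axis_part cxc rex hx /z addrAC subrr add0r scalerA.
  by rewrite mulrC divfK.
rewrite (orbit_mapE qx) rex hx -[RHS](subrK (qre w)%:A) addrC; congr (_ + _).
rewrite -/v; apply: (scalerI nr); rewrite -rv scalerA.
have d0 : qdet (Psi q) r = 0.
  by rewrite /qdet qA_pair qB_pair qr subrr.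
have := hopf_qdet d0 => /(congr1 (fun u => (h / qnorm2 (Psi q)) *: u)).
rewrite !scalerA divfK// => <-; by rewrite mulrC.
Qed.

Lemma orbit_map_invariant (k : topAut S) x :
  k \in s -> orbit_map (k x) = orbit_map x.
Proof.
move=> ks; have re : qre (\q (k x)) = qre (\q x) by exact: aut_qre.
have hE : height (k x) = height x by rewrite /height re.
have eU : orbit_AA (k x) = orbit_AA x.
  rewrite /orbit_AA hE -[RHS](perm_big _ (perm_mulr uniq_s mem_s ks)).
  by rewrite big_map.
have eV : orbit_BB (k x) = orbit_BB x.
  rewrite /orbit_BB hE -[RHS](perm_big _ (perm_mulr uniq_s mem_s ks)).
  by rewrite big_map.
have eM : orbit_AB (k x) = orbit_AB x.
  rewrite /orbit_AB -[RHS](perm_big _ (perm_mulr uniq_s mem_s ks)).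
  by rewrite big_map.
by rewrite /orbit_map re hE eU eV eM.
Qed.

Lemma orbit_AA_BB_neq0 x : height x != 0 -> orbit_AA x + orbit_BB x != 0.
Proof.
move=> h0; have [q qx] := hopf_over_ex x; have [q0 _] := qx.
have Pq := Psi_neq0 q0; have nq : qnorm2 q != 0 by rewrite qnorm2_eq0.
have := orbit_BB_lift qx; have := orbit_AA_lift qx.
move: Pq; rewrite -qnorm2_eq0.
case: (formA s m q) => a b; case: (formB s m q) => d e.
move=> P0 /(congr1 (@complex.Re R)) /= -> /(congr1 (@complex.Re R)) /= ->.
have w0 : kappa q x ^+ size s != 0.
  by rewrite expf_neq0// /kappa mulf_neq0 ?invr_neq0// mulf_neq0// pnatr_eq0.
move: P0 w0; rewrite /qnorm2 /cpair !quatE /=; move: (_ ^+ size s) => w P0 w0.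
rewrite (_ : _ + _ = w * (a ^+ 2 + b ^+ 2 + d ^+ 2 + e ^+ 2)); last by ring.
exact: mulf_neq0.
Qed.

End OrbitMap.

(** * Continuity of the orbit map *)

Section Continuity.
Variables (R : realType).
Local Notation S := (Sp1 R).
Local Notation "\q x" := (set_val x : quat R) (at level 10).

Lemma quat_coord_continuous (T : topologicalType) (F : T -> quat R) :
  continuous F ->
  [/\ continuous (fun t => qre (F t)), continuous (fun t => qi (F t)),
      continuous (fun t => qj (F t)) & continuous (fun t => qk (F t))].
Proof.
have H i : continuous F -> continuous (fun t => F t ord0 i).
  move=> cF t; apply: (@continuous_comp T (quat R) R F (fun q => q ord0 i)).
    exact: cF.
  exact: coord_continuous.
by split; exact: H.
Qed.

Lemma quat_mul_continuous (T : topologicalType) (F H : T -> quat R) :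
  continuous F -> continuous H -> continuous (fun t => F t * H t).
Proof.
move=> /quat_coord_continuous[a0 a1 a2 a3] /quat_coord_continuous[b0 b1 b2 b3].
apply: quat_continuous.
- under eq_fun do rewrite qreM.
  apply: cts_sub; first (apply: cts_sub; first apply: cts_sub); exact: cts_mul.
- under eq_fun do rewrite qiM.
  apply: cts_sub; first (apply: cts_add; first apply: cts_add); exact: cts_mul.
- under eq_fun do rewrite qjM.
  apply: cts_add; first (apply: cts_add; first apply: cts_sub); exact: cts_mul.
- under eq_fun do rewrite qkM.
  apply: cts_add; first (apply: cts_sub; first apply: cts_add); exact: cts_mul.
Qed.

Lemma real_prod_continuous (T : topologicalType) (I : Type) (s : seq I)
    (F : I -> T -> R) :
  (forall i, continuous (F i)) -> continuous (fun t => \prod_(i <- s) F i t).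
Proof.
move=> cF; elim: s => [|i s IH].
  by under eq_fun do rewrite big_nil; exact: cts_cst.
by under eq_fun do rewrite big_cons; exact: cts_mul.
Qed.

Lemma complex_prod_continuous (T : topologicalType) (I : Type) (s : seq I)
    (F : I -> T -> R[i]) :
  (forall i, continuous (fun t => Re (F i t))) ->
  (forall i, continuous (fun t => Im (F i t))) ->
  continuous (fun t => Re (\prod_(i <- s) F i t)) /\
  continuous (fun t => Im (\prod_(i <- s) F i t)).
Proof.
move=> cr ci; elim: s => [|i s [IHr IHi]].
  by split; under eq_fun do rewrite big_nil; exact: cts_cst.
have ReM (u v : R[i]) : Re (u * v) = Re u * Re v - Im u * Im v.
  by case: u; case: v.
have ImM (u v : R[i]) : Im (u * v) = Re u * Im v + Im u * Re v.
  by case: u; case: v.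
split; under eq_fun do rewrite big_cons ?ReM ?ImM.
  by apply: cts_sub; exact: cts_mul.
by apply: cts_add; exact: cts_mul.
Qed.

(** Where [d] may vanish so does [h], and there the bound forces the limit. *)
Lemma squeezed_quotient_continuous (T : topologicalType) (h n d : T -> R) :
  continuous h -> continuous n -> continuous d ->
  (forall t, h t != 0 -> d t != 0) ->
  (forall t, `|h t / d t * n t| <= h t) ->
  continuous (fun t => h t / d t * n t).
Proof.
move=> ch cn cd d0 bnd t.
have [h0|h0] := eqVneq (h t) 0; last first.
  by apply: cvgM (cn t); apply: cvgM (ch t) _; apply: cvgV (cd t); exact: d0.
rewrite /continuous_at h0 mul0r mul0r.
apply/cvgr0Pnorm_lt => e e0.
have := ch t; rewrite /continuous_at h0 => /cvgr0Pnorm_lt/(_ e e0).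
apply: filterS => x; apply: le_lt_trans.
by apply: le_trans (bnd x) _; exact: ler_norm.
Qed.

Lemma set_val_sp1_continuous : continuous (fun x : S => \q x).
Proof. exact: initial_continuous. Qed.

Lemma aut_val_continuous (f : topAut S) : continuous (fun x : S => \q (f x)).
Proof.
move=> x; apply: (@continuous_comp _ _ _ f (fun x : S => \q x)).
  by have [_ [g [_ _ cf _]]] := autP f; exact: cf.
exact: set_val_sp1_continuous.
Qed.
End Continuity.

Section OrbitMapContinuous.
Variables (R : realType) (s : seq (topAut (Sp1 R))) (c : quat R).
Local Notation S := (Sp1 R).
Local Notation "\q x" := (set_val x : quat R) (at level 10).

Hypothesis orbit_map_norm : forall x, qnorm2 (orbit_map s c x) = 1.
Hypothesis AA_BB_neq0 : forall x : S, height x != 0 ->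
  orbit_AA s c x + orbit_BB s c x != 0.

(** The imaginary coordinates are bounded by [height x] because the image has
    norm one and the same real part as [x]; this settles continuity at [1] and
    [-1]. *)
Lemma orbit_map_continuous : continuous (orbit_map s c).
Proof.
have cre : continuous (fun x : S => qre (\q x)).
  by have [] := quat_coord_continuous (@set_val_sp1_continuous R).
have ch : continuous (@height R).
  apply: cts_sqrt; apply: cts_sub; first exact: cts_cst.
  by under eq_fun do rewrite expr2; exact: cts_mul.
have cy f : continuous (fun x : S => conj_aut c f x).
  apply: quat_mul_continuous; last exact: cst_continuous.
  apply: quat_mul_continuous; first exact: cst_continuous.
  exact: aut_val_continuous.
have cyi f : continuous (fun x : S => qi (conj_aut c f x)).
  by have [] := quat_coord_continuous (cy f).
have cyj f : continuous (fun x : S => qj (conj_aut c f x)).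
  by have [] := quat_coord_continuous (cy f).
have cyk f : continuous (fun x : S => qk (conj_aut c f x)).
  by have [] := quat_coord_continuous (cy f).
have cA : continuous (orbit_AA s c).
  by apply: real_prod_continuous => f; apply: cts_add; [exact: ch|exact: cyi].
have cB : continuous (orbit_BB s c).
  by apply: real_prod_continuous => f; apply: cts_sub; [exact: ch|exact: cyi].
have [cMr cMi] : continuous (fun x => Re (orbit_AB s c x)) /\
    continuous (fun x => Im (orbit_AB s c x)).
  apply: complex_prod_continuous => f /=; first exact: cyk.
  by apply: cts_opp; exact: cyj.
have bnd x (g : quat R -> R) :
    qre (orbit_map s c x) ^+ 2 + g (orbit_map s c x) ^+ 2
      <= qnorm2 (orbit_map s c x) -> `|g (orbit_map s c x)| <= height x.
  rewrite orbit_map_norm {1}/orbit_map qreE => H.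
  rewrite -(@ger0_norm _ (height x)) ?height_ge0// -ler_sqr ?nnegrE//.
  rewrite !real_normK ?num_real// sqr_height; lra.
have bi x : `|qi (orbit_map s c x)| <= height x.
  apply: bnd; rewrite /qnorm2; move: (qre _) (qi _) (qj _) (qk _) => a b d e.
  by have := sqr_ge0 d; have := sqr_ge0 e; lra.
have bj x : `|qj (orbit_map s c x)| <= height x.
  apply: bnd; rewrite /qnorm2; move: (qre _) (qi _) (qj _) (qk _) => a b d e.
  by have := sqr_ge0 b; have := sqr_ge0 e; lra.
have bk x : `|qk (orbit_map s c x)| <= height x.
  apply: bnd; rewrite /qnorm2; move: (qre _) (qi _) (qj _) (qk _) => a b d e.
  by have := sqr_ge0 d; have := sqr_ge0 b; lra.
have cD : continuous (fun x => orbit_AA s c x + orbit_BB s c x).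
  exact: cts_add.
apply: quat_continuous.
- by under eq_fun do rewrite qreE.
- under eq_fun do rewrite qiE; apply: squeezed_quotient_continuous => //.
    exact: cts_sub.
  by move=> x; have := bi x; rewrite /orbit_map qiE.
- under eq_fun do rewrite qjE; apply: squeezed_quotient_continuous => //.
    by apply: cts_mul => //; exact: cts_cst.
  by move=> x; have := bj x; rewrite /orbit_map qjE.
- under eq_fun do rewrite qkE; apply: squeezed_quotient_continuous => //.
    by apply: cts_mul => //; exact: cts_cst.
  by move=> x; have := bk x; rewrite /orbit_map qkE.
Qed.
End OrbitMapContinuous.

(** * Compactness and the homeomorphism *)

Section CompactToHausdorff.

Lemma compact_bijection_homeomorphic (X Y : topologicalType) (F : X -> Y) :
  compact [set: X] -> hausdorff_space Y -> continuous F -> injective F ->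
  (forall y, exists x, F x = y) -> homeomorphic X Y.
Proof.
move=> cX hY cF injF surjF.
pose H y := sval (cid (surjF y)).
have HK : cancel H F by move=> y; exact: (svalP (cid (surjF y))).
have FK : cancel F H by move=> x; apply: injF; rewrite HK.
exists F, H; split=> //; apply/continuous_closedP => A clA.
have -> : H @^-1` A = F @` A.
  apply/seteqP; split=> [y Ay|_ [x Ax <-]]; first by exists (H y).
  by rewrite /preimage /= FK.
apply: compact_closed => //; apply: continuous_compact.
  exact: continuous_subspaceT.
exact: (subclosed_compact clA cX).
Qed.

Lemma compact_set_type (T : topologicalType) (A : set T) :
  compact A -> compact [set: set_type A].
Proof.
move=> cA F PF FT.
pose f : set_type A -> T := set_val.
have PG : ProperFilter (f @ F) by exact: fmap_proper_filter.
have GA : (f @ F) A.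
  have : F (f @^-1` A) by apply: filterS FT => x _; exact: set_valP.
  by [].
have [a [Aa cla]] := cA _ PG GA.
exists (exist _ a (mem_set Aa)); split=> // B C FB [D [ [U oU <-] Ua UC]].
have : ((f @` B) `&` U) !=set0.
  apply: cla; last by apply: open_nbhs_nbhs; split.
  have : F (f @^-1` (f @` B)) by apply: filterS FB => x Bx; exists x.
  by [].
move=> [y [/= [b Bb by_] Oy]]; rewrite -by_ in Oy.
by exists b; split=> //; exact: UC.
Qed.

Lemma hausdorff_set_type (T : topologicalType) (A : set T) :
  hausdorff_space T -> hausdorff_space (set_type A).
Proof.
move=> hT p q cl; apply/val_inj/hT => B C pB qC.
have [x [Bx Cx]] := cl _ _ (initial_continuous pB) (initial_continuous qC).
by exists (set_val x).
Qed.
End CompactToHausdorff.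

Lemma qnorm2_sum (R : realType) (q : quat R) :
  \sum_i q ord0 i ^+ 2 = qnorm2 q.
Proof.
rewrite !big_ord_recl big_ord0 addr0 !addrA /qnorm2 /qre /qi /qj /qk.
by congr (_ ^+ 2 + _ ^+ 2 + _ ^+ 2 + _ ^+ 2); congr (q _ _); exact: val_inj.
Qed.

Lemma sp1_compact (R : realType) : compact [set: Sp1 R].
Proof.
apply: compact_set_type.
have cbox := @rV_compact R 4 (fun=> `[-1, 1]%classic)
  (fun=> @segment_compact _ _ _).
apply: (subclosed_compact _ cbox) => [|q q1 i]; last first.
  have qi1 : (q ord0 i) ^+ 2 <= 1.
    rewrite -q1 -qnorm2_sum (bigD1 i)//= lerDl sumr_ge0// => j _.
    exact: sqr_ge0.
  by rewrite /= in_itv /=; apply/andP; split; nra.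
have [c0 c1 c2 c3] := @quat_coord_continuous R (quat R) id (fun x => cvg_id).
have cn : continuous (@qnorm2 R).
  rewrite /qnorm2; under eq_fun do rewrite !expr2.
  by do 3?[apply: cts_add]; apply: cts_mul.
apply: (preimage_closed _ (@closed_eq R 1)).
by move=> x _; exact: cn.
Qed.

Local Open Scope card_scope.

Theorem theorem1 (R : realType) (n : nat) (G : groupClosed (topAut (Sp1 R)))
    (order_G : [set g : topAut (Sp1 R) | g \in G] #= `I_n) :
  homeomorphic (coset_space G) (sphere R 3).
Proof.
have /finite_seqP[s0 s0E] : finite_set [set g : topAut (Sp1 R) | g \in G].
  by exists n.
pose s := undup s0.
have uniq_s : uniq s by exact: undup_uniq.
have mem_s f : (f \in s) = (f \in G).
  rewrite mem_undup; apply/idP/idP => h.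
    by have : [set` s0] f by []; rewrite -s0E.
  by have : [set g : topAut (Sp1 R) | g \in G] f by []; rewrite s0E.
have [c c1 sep] := generic_conj_lift s.
have sphereP x :
    [set v : 'rV[R]_4 | \sum_i v ord0 i ^+ 2 = 1] (orbit_map s c x).
  by rewrite /= qnorm2_sum (orbit_map_unit c1 sep).
pose F0 (x : Sp1 R) : sphere R 3 :=
  exist _ (orbit_map s c x : 'rV[R]_4) (mem_set (sphereP x)).
have F0c : continuous F0.
  apply: continuous_comp_initial; apply: orbit_map_continuous.
    by move=> x; exact: (orbit_map_unit c1 sep).
  by move=> x; exact: (orbit_AA_BB_neq0 c1 sep).
pose F (o : coset_space G) : sphere R 3 := F0 (repr o).
have FE x : F (\pi_(coset_space G) x)%qT = F0 x.
  have /eqmodP/asboolP[k Gk kx] :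
      (repr (\pi_(coset_space G) x) = x %[mod {eq_quot orbit_rel G}])%qT.
    by rewrite reprK.
  apply: val_inj; rewrite /= -[in RHS]kx (orbit_map_invariant c uniq_s mem_s)//.
  by rewrite mem_s.
have piE (x y : Sp1 R) (f : topAut (Sp1 R)) : f \in G -> f x = y ->
    \pi_(coset_space G) x = \pi_(coset_space G) y.
  by move=> Gf fx; apply/eqmodP/asboolP; exists f.
have pi_cont : continuous (\pi_(coset_space G)%qT : Sp1 R -> coset_space G).
  exact: pi_continuous.
apply: (@compact_bijection_homeomorphic _ _ F).
- rewrite (_ : [set: coset_space G] = (\pi_(coset_space G))%qT @` [set: Sp1 R]).
    apply: continuous_compact; last exact: sp1_compact.
    exact: continuous_subspaceT.
  by apply/seteqP; split=> // o _; exists (repr o); rewrite ?reprK.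
- by apply: hausdorff_set_type; exact: norm_hausdorff.
- apply/quotient_continuous.
  rewrite (_ : F \o _ = F0); first exact: F0c.
  by apply/funext => x; exact: FE.
- move=> o o'; rewrite -(reprK o) -(reprK o') !FE => /(congr1 val) /= E.
  have [g [h [gs hs ghE]]] := orbit_map_inj c1 uniq_s mem_s sep E.
  rewrite mem_s in gs; rewrite mem_s in hs.
  by rewrite (piE (repr o) _ g gs erefl) (piE (repr o') _ h hs erefl) ghE.
- move=> y; have y1 : qnorm2 (set_val y : quat R) = 1.
    by rewrite -qnorm2_sum; exact: (set_valP y).
  have [x xy] := orbit_map_surj c1 mem_s sep y1.
  by exists (\pi_(coset_space G) x)%qT; rewrite FE; exact: val_inj.
Qed.
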